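(* Suppose that $\Gamma$ is a countably infinite amenable group that acts by homeomorphisms on compact metric spaces $X$ and $Y$, and that $\pi: X \to Y$ is a topologically prime extension. Then $h_\Gamma(X) = h_\Gamma(Y)$.
   Context: $h_\Gamma(X)$ denotes the topological entropy of the action of the countable amenable group $\Gamma$ on the compact space $X$. A topological factor map $\pi: X\to Y$ between actions of $\Gamma$ is a continuous surjective $\Gamma$-equivariant map. It is a topologically prime extension if the action of $\Gamma$ on $X$ has no (strictly) intermediate factors; equivalently, there is no $\Gamma$-invariant $C^*$-subalgebra $A$ of $C(X)$ with $\pi_*(C(Y)) \subsetneq A \subsetneq C(X)$, where $C(X)$ is the algebra of continuous complex-valued functions on $X$ and $\pi_*(h)=h\circ\pi$. *)

(* Defs.v *)
From HB Require Import structures.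
From mathcomp Require Import all_boot all_order all_algebra.
From mathcomp Require Import finmap.
From mathcomp Require Import all_classical all_reals all_analysis.
Set Implicit Arguments.
Unset Strict Implicit.
Unset Printing Implicit Defensive.
Import Order.TTheory GRing.Theory Num.Theory.
Local Open Scope classical_set_scope.
Local Open Scope ring_scope.

(* [F] is nonempty and |sF Delta F| <= e |F| for every s in [K]. *)
Definition folner_invariant (G : groupType) (K : {fset G}) (e : rat)
    (F : {fset G}) : Prop :=
  F <> fset0 /\
  forall s : G, s \in K ->
    let sF := [fset (s * x)%g | x in F]%fset in
    #|` ((sF `\` F) `|` (F `\` sF))%fset |%:R <= e * #|` F|%:R.

(* Amenability of a discrete group, as the Folner condition. *)
Definition amenable (G : groupType) : Prop :=
  forall (K : {fset G}) (e : rat), 0 < e -> exists F, folner_invariant K e F.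

(* "[F] becomes more and more (left) invariant". *)
Definition folner_filter (G : groupType) : set_system {fset G} :=
  filter_from [set Ke : {fset G} * rat | 0 < Ke.2]
              (fun Ke => [set F | folner_invariant Ke.1 Ke.2 F]).
Arguments folner_filter : clear implicits.

(* Each [act g] is a homeomorphism, with inverse [act g^-1]. *)
Record topological_action (G : groupType) (X : topologicalType) :=
  TopologicalAction {
    act :> G -> X -> X;
    topact1 : forall x, act 1%g x = x;
    topactM : forall g h x, act (g * h)%g x = act g (act h x);
    topact_continuous : forall g, continuous (act g) }.

Section Entropy.
Context (R : realType).

Definition open_cover (X : topologicalType) (U : set (set X)) : Prop :=
  (forall V, U V -> open V) /\ \bigcup_(V in U) V = [set: X].

(* N(U); [inf] is a minimum as soon as [U] has a finite subcover, which holds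
   for every open cover of a compact space. *)
Definition subcover_number (X : Type) (U : set (set X)) : R :=
  inf [set n%:R | n in [set n : nat | exists W : set (set X),
    [/\ W `<=` U, \bigcup_(V in W) V = [set: X] & (W #= `I_n)%card]]].

Context (G : groupType) (X : topologicalType) (a : topological_action G X).

(* The join of the covers s^-1 U, for s in [F]. *)
Definition cover_join (U : set (set X)) (F : {fset G}) : set (set X) :=
  [set W | exists2 V : G -> set X, (forall s, s \in F -> U (V s)) &
     W = \bigcap_(s in [set` F]) (a s @^-1` V s)].

(* The limit of log N(U^F) / |F| as F becomes more and more invariant, written
   as an upper limit; it is a genuine limit by the Ornstein-Weiss lemma, and
   the limit along any Folner sequence. *)
Definition cover_entropy (U : set (set X)) : \bar R :=
  ereal_inf [set ereal_sup
      [set (ln (subcover_number (cover_join U F)) / #|` F|%:R)%:E | F in S]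
    | S in folner_filter G].

Definition topological_entropy : \bar R :=
  ereal_sup [set cover_entropy U | U in @open_cover X].

End Entropy.
Arguments topological_entropy R {G X} a.

Definition factor_map (G : groupType) (X Y : topologicalType)
    (a : topological_action G X) (b : topological_action G Y)
    (f : X -> Y) : Prop :=
  [/\ continuous f, set_surj [set: X] [set: Y] f &
      forall g x, f (a g x) = b g (f x)].

Definition is_homeomorphism (X Y : topologicalType) (f : X -> Y) : Prop :=
  continuous f /\
  exists h : Y -> X, [/\ continuous h, cancel f h & cancel h f].

(* An intermediate factor X -> Z -> Y is strict when neither of the two maps is
   an isomorphism of actions. Compact Hausdorff factors Z correspond to the
   invariant C*-subalgebras of C(X); they are metrizable when X is. *)
Definition topologically_prime_extension (G : groupType)
    (X Y : topologicalType)
    (a : topological_action G X) (b : topological_action G Y)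
    (pi : X -> Y) : Prop :=
  factor_map a b pi /\
  ~ exists (Z : topologicalType) (c : topological_action G Z)
           (p : X -> Z) (q : Z -> Y),
      [/\ compact [set: Z], hausdorff_space Z,
          factor_map a c p, factor_map c b q & q \o p =1 pi] /\
      (~ is_homeomorphism p /\ ~ is_homeomorphism q).

(* Main.v *)
Require Import Defs.
From HB Require Import structures.
From mathcomp Require Import all_boot all_order all_algebra.
From mathcomp Require Import finmap zify ring lra.
From mathcomp Require Import all_classical all_reals all_analysis.
Set Implicit Arguments.
Unset Strict Implicit.
Unset Printing Implicit Defensive.
Import Order.TTheory GRing.Theory Num.Theory.
Import numFieldNormedType.Exports.

(** Suppose the entropy of X exceeds that of Y. A function f on X that separates
    two points of a fiber of pi, but takes equal values along the orbits of two
    other points x <> x' of a common fiber, makes the pair (pi, orbit of values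
    of f) a strict intermediate factor. Such an f is found as follows. For a
    bump function around a point x0, the times at which an orbit is inside or
    outside a small ball are described by a code of small entropy, up to a small
    proportion of times spent in a thin annulus: being close to x0 at time g
    decides where the orbit is at the times k g, for k in a large finite set K.
    Composing the bump with steeper and steeper staircases (a devil's staircase
    in the limit), each of which climbs where the given orbits seldom pass, makes
    the itineraries at all scales 2^-k cheap to describe, at a cost independent
    of k. The entropy gap provides exponentially many orbits over a Folner set
    that are separated in X and indistinguishable in Y, so two of them have close
    itineraries for such a staircase. As the staircases range over a compact set
    of parameters, an ultrafilter gives a single f, x and x'. *)

(** * Finite combinatorics *)

Section Pigeonhole.
Implicit Types (T L : finType).

(** [Q'] is the largest fiber of [f] in [Q]. *)
Lemma pigeonhole T L (f : T -> L) (Q : {set T}) (P : {set L}) :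
  (forall x, x \in Q -> f x \in P) ->
  exists Q' : {set T},
    [/\ Q' \subset Q, (forall x y, x \in Q' -> y \in Q' -> f x = f y) &
        (#|Q| <= #|Q'| * #|P|)%N].
Proof.
move=> fP.
have [Q0|[x xQ]] := set_0Vmem Q.
  by exists finset.set0; split=> [|x y|]; rewrite ?finset.sub0set ?inE // Q0 cards0.
pose c l := #|[set y in Q | f y == l]%SET|.
have [l lP lmax] := arg_maxnP c (fP x xQ).
exists [set y in Q | f y == l]%SET; split.
- by apply/fintype.subsetP => y; rewrite !inE => /andP[].
- by move=> y z; rewrite !inE => /andP[_ /eqP->] /andP[_ /eqP->].
have -> : #|Q| = (\sum_(l' in P) c l')%N.
  rewrite -sum1_card (partition_big f (mem P)) /=; last by move=> i /fP.
  apply: eq_bigr => l' _; rewrite /c -sum1_card; apply: eq_bigl => y.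
  by rewrite inE.
by rewrite mulnC -sum_nat_const; apply: leq_sum => i /lmax.
Qed.

(** In the binomial expansion of [n.+1 ^ #|I|], the term of index [i <= m] counts the subsets with
    [i] elements with a weight at least [n ^ (#|I| - m)]. *)
Lemma card_bounded_subsets (I : finType) (m n : nat) : (0 < n)%N -> (m <= #|I|)%N ->
  (#|[set B : {set I} | #|B| <= m]%SET| * n ^ (#|I| - m) <= n.+1 ^ #|I|)%N.
Proof.
move=> n0 mI.
have -> : #|[set B : {set I} | #|B| <= m]%SET| = (\sum_(i < m.+1) 'C(#|I|, i))%N.
  rewrite -sum1_card (partition_big (fun B : {set I} => inord #|B| : 'I_m.+1) xpredT) //=.
  apply: eq_bigr => i _; rewrite -card_draws -sum1_card.
  apply: eq_bigl => B; rewrite !inE.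
  apply/andP/eqP => [[Bm /eqP <-]|Bi]; first by rewrite inordK ?ltnS.
  by rewrite Bi -ltnS ltn_ord; split=> //; apply/eqP; apply: val_inj;
    rewrite /= inordK ?ltnS// -ltnS ltn_ord.
rewrite big_distrl /= -(addn1 n) expnDn.
rewrite (big_ord_widen #|I|.+1 (fun i => 'C(#|I|, i) * n ^ (#|I| - m)))%N ?ltnS//.
rewrite big_mkcond /=; apply: leq_sum => i _; case: ifP => // im.
by rewrite exp1n muln1 leq_mul2l leq_pexp2l ?orbT// leq_sub2l.
Qed.

(** Averaging: a point of [A] lies in at most one [F j], so the cardinals add up to at most
    [#|A|]. *)
Lemma least_of_disjoint (I : finType) (n : nat) (F : 'I_n -> {set I}) (A : {set I}) :
  (0 < n)%N -> (forall j, F j \subset A) ->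
  (forall i j j', i \in F j -> i \in F j' -> j = j') ->
  exists j, (n * #|F j| <= #|A|)%N.
Proof.
case: n F => // n F _ FA Fdisj.
have [j _ jmin] := @arg_minnP _ (ord0 : 'I_n.+1) xpredT (fun j => #|F j|) isT; exists j.
apply: (@leq_trans (\sum_(j' < n.+1) #|F j'|)%N).
  apply: (@leq_trans (\sum_(j' < n.+1) #|F j|)%N); first by rewrite sum_nat_const card_ord.
  by apply: leq_sum => j' _; exact: jmin.
have FE j' : #|F j'| = (\sum_(i in A) (i \in F j'))%N.
  rewrite -sum1_card big_mkcond [RHS]big_mkcond; apply: eq_bigr => i _.
  by case: ifP => [iF|_]; rewrite ?(fintype.subsetP (FA j') _ iF)// if_same.
under eq_bigr do rewrite FE; rewrite exchange_big -sum1_card; apply: leq_sum => i _.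
have [j0 ij0|noj] := pickP (fun j' => i \in F j'); last by rewrite big1// => j' _; rewrite noj.
rewrite (bigD1 j0)//= big1 ?addn0 ?leq_b1// => j' j'j0.
by apply/eqP; rewrite eqb0; apply: contraNN j'j0 => ij'; apply/eqP; exact: Fdisj ij' ij0.
Qed.

(** [B] is a maximal subset of [S] whose translates [K * f i] are pairwise disjoint. Disjointness
    gives the packing bound; by maximality every other translate meets one of these, which is the
    last clause. *)
Lemma separated_centers (G : groupType) (I : finType) (f : I -> G) (S : {set I})
    (K : {fset G}) : injective f ->
  exists B : {set I},
    [/\ B \subset S,
      (forall E : {fset G}, (forall i s, s \in K -> (s * f i)%g \in E) ->
         #|` K| * #|B| <= #|` E|)%N &
      forall i, i \in S -> K <> fset0 -> exists j s s',
        [/\ j \in B, s \in K, s' \in K & f i = (s^-1 * (s' * f j))%g]].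
Proof.
move=> finj.
pose sep (B : {set I}) := (B \subset S) && [forall i in B, forall j in B,
  [forall s : K, forall s' : K, (val s * f i == val s' * f j)%g ==> (i == j)]].
have [|B /maxsetP[/andP[BS Bsep] Bmax] _] := @maxset_exists _ sep finset.set0.
  by rewrite /sep finset.sub0set; apply/forall_inP => i; rewrite inE.
have BsepP i j s s' : i \in B -> j \in B -> s \in K -> s' \in K ->
    (s * f i = s' * f j)%g -> i = j.
  move=> iB jB sK s'K /eqP e; move: Bsep.
  move=> /forall_inP/(_ i iB)/forall_inP/(_ j jB)/forallP/(_ [` sK]%fset).
  by move=> /forallP/(_ [` s'K]%fset)/implyP/(_ e)/eqP.
exists B; split=> // [E KE|i iS /eqP/fset0Pn[s0 s0K]].
  rewrite cardE -(size_allpairs (fun s i => s * f i)%g) uniq_leq_size//.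
    apply: allpairs_uniq; rewrite ?fset_uniq ?enum_uniq// => -[s i] [s' i'].
    move=> /allpairsP[[? ?] /= [sK + [-> ->]]] /allpairsP[[? ?] /= [s'K + [-> ->]]].
    rewrite !mem_enum => iB i'B /= e; have ii' := BsepP _ _ _ _ iB i'B sK s'K e.
    by move: e; rewrite ii' => /mulIg ->.
  by move=> g /allpairsP[[s i] /= [sK _ ->]]; exact: KE.
(* A center is its own witness, through any element of [K]. *)
have [iB|iB] := boolP (i \in B); first by exists i, s0, s0; rewrite mulKg.
apply: contrapT => nocol; move/negP: iB; apply.
have nocolP j s s' : j \in B -> s \in K -> s' \in K -> (s * f i = s' * f j)%g -> False.
  by move=> jB sK s'K e; apply: nocol; exists j, s, s'; rewrite -e mulKg.
rewrite -(Bmax (i |: B)%SET) ?finset.setU11 ?finset.subsetUr//.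
rewrite /sep finset.subUset finset.sub1set iS BS /=.
apply/forall_inP => j jB; apply/forall_inP => j' j'B.
apply/forallP => s; apply/forallP => s'; apply/implyP => /eqP e.
move: jB j'B; rewrite !finset.in_setU1 => /orP[/eqP ji|jB] /orP[/eqP j'i|j'B].
- by rewrite ji j'i.
- by have := nocolP _ _ _ j'B (valP s) (valP s'); rewrite -ji => /(_ e).
- by have := nocolP _ _ _ jB (valP s') (valP s); rewrite -j'i => /(_ (esym e)).
- by rewrite (BsepP _ _ _ _ jB j'B (valP s) (valP s') e).
Qed.
End Pigeonhole.

Local Open Scope classical_set_scope.

(** * Staircase functions *)

Section Staircase.
Context (R : realType).
Local Open Scope ring_scope.
Implicit Types s u v : R.

Definition clamp s : R := Num.max 0 (Num.min 1 s).

Lemma clamp_itv s : 0 <= clamp s <= 1.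
Proof. by rewrite /clamp le_max lexx /= ge_max ler01 ge_min lexx. Qed.

Lemma clamp_le0 s : s <= 0 -> clamp s = 0.
Proof.
by move=> s0; apply/max_idPl; rewrite ge_min s0 orbT.
Qed.

Lemma clamp_ge1 s : 1 <= s -> clamp s = 1.
Proof. by move=> s1; rewrite /clamp (min_idPl s1); apply/max_idPr. Qed.

Lemma continuous_clamp : continuous clamp.
Proof.
move=> s; apply: continuous_max; first exact: cvg_cst.
by apply: continuous_min; [exact: cvg_cst|exact: cvg_id].
Qed.

(* A staircase with [n] steps: on each [i/n, (i+1)/n] it climbs from i/n to
   (i+1)/n inside the quarter number [tau] of the interval only. *)
Definition stair (n tau : nat) s : R :=
  n%:R^-1 * \sum_(i < n) clamp (4%:R * (n%:R * s - i%:R) - tau%:R).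

Lemma continuous_stair n tau : continuous (stair n tau).
Proof.
move=> s; apply: cvgM; first exact: cvg_cst.
apply: cvg_big => [|i _]; first exact: add_continuous.
apply: (@continuous_comp _ _ _ (fun s => 4%:R * (n%:R * s - i%:R) - tau%:R) clamp);
  last exact: continuous_clamp.
apply: cvgB; last exact: cvg_cst.
apply: cvgM; first exact: cvg_cst.
apply: cvgB; last exact: cvg_cst.
by apply: cvgM; [exact: cvg_cst|exact: cvg_id].
Qed.

Lemma stair_itv n tau s : 0 <= stair n tau s <= 1.
Proof.
case: n => [|n]; first by rewrite /stair invr0 mul0r lexx ler01.
apply/andP; split.
  apply: mulr_ge0; first by rewrite invr_ge0.
  by apply: sumr_ge0 => i _; case/andP: (clamp_itv (4%:R * (n.+1%:R * s - i%:R) - tau%:R)).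
rewrite /stair mulrC ler_pdivrMr// mul1r.
apply: (@le_trans _ _ (\sum_(i < n.+1) 1)); last by rewrite sumr_const card_ord.
by apply: ler_sum => i _; case/andP: (clamp_itv (4%:R * (n.+1%:R * s - i%:R) - tau%:R)).
Qed.

Lemma stair0 n tau : stair n tau 0 = 0.
Proof.
rewrite /stair big1 ?mulr0// => i _; apply: clamp_le0.
have := ler0n R i; have := ler0n R tau; lra.
Qed.

Lemma stair1 n tau : (0 < n)%N -> (tau < 4)%N -> stair n tau 1 = 1.
Proof.
move=> n0 t4; rewrite /stair (eq_bigr (fun=> 1)) => [|i _].
  by rewrite sumr_const card_ord mulVf// pnatr_eq0 -lt0n.
apply: clamp_ge1; have : i.+1%:R <= n%:R :> R by rewrite ler_nat.
have : tau.+1%:R <= 4%:R :> R by rewrite ler_nat.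
rewrite -(natr1 i) -(natr1 tau); lra.
Qed.

Lemma stair_close n tau s : (0 < n)%N -> (tau < 4)%N -> 0 <= s <= 1 ->
  `|stair n tau s - s| <= n%:R^-1.
Proof.
move=> n0 t4 s01.
have t4R : tau%:R <= 3 :> R by rewrite (ler_nat R _ 3).
have t0R := ler0n R tau.
(* Only one summand can be partly climbed: when [u <= m] the new one vanishes, and when [u > m] all
   the earlier ones equal 1. *)
have key (m : nat) (u : R) : 0 <= u <= m%:R ->
    u - 1 <= \sum_(i < m) clamp (4%:R * (u - i%:R) - tau%:R) <= u + 1.
  elim: m => [|m IH] u01; first by rewrite big_ord0; lra.
  rewrite big_ord_recr /=.
  have /andP[c0 c1] := clamp_itv (4%:R * (u - m%:R) - tau%:R).
  have [um|um] := leP u m%:R.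
    rewrite clamp_le0 ?addr0; last by lra.
    by apply: IH; lra.
  rewrite (eq_bigr (fun=> 1)) => [|i _].
    by rewrite sumr_const card_ord; move: u01; rewrite -natr1; lra.
  apply: clamp_ge1; have : i.+1%:R <= m%:R :> R by rewrite ler_nat.
  rewrite -natr1; lra.
have nR : 0 < n%:R :> R by rewrite ltr0n.
have /key : 0 <= n%:R * s <= n%:R.
  by case/andP: s01 => s0 s1; rewrite mulr_ge0 ?ler0n//= ler_piMr.
rewrite /stair; set S := \sum_(i < n) _ => /andP[S1 S2].
have -> : n%:R^-1 * S - s = n%:R^-1 * (S - n%:R * s).
  by rewrite mulrBr mulrA mulVf ?mul1r// gt_eqF.
rewrite normrM ger0_norm ?invr_ge0 ?ler0n// ler_piMr ?invr_ge0 ?ler0n// ler_norml.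
by apply/andP; split; lra.
Qed.

(** The integer [m] numbers a quarter of a step. In a quarter other than [tau] every summand is
    saturated, at 1 or at 0 according to the order of [4 * i + tau] and [m]. *)
Lemma stair_const n tau (m : nat) s s' : (m %% 4 != tau)%N -> (tau < 4)%N ->
  m%:R <= 4%:R * (n%:R * s) < m.+1%:R -> m%:R <= 4%:R * (n%:R * s') < m.+1%:R ->
  stair n tau s = stair n tau s'.
Proof.
move=> mt t4 ms ms'; congr (_ * _); apply: eq_bigr => i _.
have [lt|ge] := leqP (4 * i + tau).+1 m.
  have : (4 * i + tau).+1%:R <= m%:R :> R by rewrite ler_nat.
  rewrite -natr1 natrD natrM => ltR.
  by rewrite !clamp_ge1//; lra.
have : m.+1%:R <= (4 * i + tau)%:R :> R.
  rewrite ler_nat ltn_neqAle -ltnS ge andbT; apply: contraNneq mt => ->.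
  by rewrite mulnC modnMDl modn_small.
rewrite natrD natrM => geR.
by rewrite !clamp_le0//; lra.
Qed.

(** Each stage acts on the values of the earlier ones, so its quarter can be chosen once these are
    known. *)
Fixpoint stairs (tau : nat -> 'I_4) (k : nat) s : R :=
  if k is k'.+1 then stair (2 ^ k') (tau k') (stairs tau k' s) else s.

Lemma continuous_stairs tau k : continuous (stairs tau k).
Proof.
elim: k => [|k IH] s /=; first exact: cvg_id.
by apply: (@continuous_comp _ _ _ (stairs tau k) (stair (2 ^ k) (tau k)));
  [exact: IH|exact: continuous_stair].
Qed.

Lemma stairs_itv tau k s : 0 <= s <= 1 -> 0 <= stairs tau k s <= 1.
Proof. by case: k => //= k _; exact: stair_itv. Qed.

Lemma stairs0 tau k : stairs tau k 0 = 0.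
Proof. by elim: k => //= k ->; exact: stair0. Qed.

Lemma stairs1 tau k : stairs tau k 1 = 1.
Proof. by elim: k => //= k ->; rewrite stair1 ?expn_gt0. Qed.

Lemma eq_stairs tau tau' k : (forall i, (i < k)%N -> tau i = tau' i) ->
  stairs tau k =1 stairs tau' k.
Proof.
elim: k => //= k IH tt s; rewrite tt// IH// => i ik.
by rewrite tt// ltnS ltnW.
Qed.

(** [stair_close] telescopes. The bound is kept as an exact difference of two geometric tails so
    that the induction closes. *)
Lemma stairs_cauchy tau k l s : 0 <= s <= 1 ->
  `|stairs tau (k + l) s - stairs tau k s| <= 2%:R * 2%:R ^- k - 2%:R * 2%:R ^- (k + l).
Proof.
move=> s01; elim: l => [|l IH]; first by rewrite addn0 !subrr normr0.
rewrite addnS; have /= := @stair_close (2 ^ (k + l)) (tau (k + l)%N) (stairs tau (k + l) s).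
rewrite expn_gt0 ltn_ord stairs_itv// natrX => /(_ isT isT isT) H.
apply: (le_trans (ler_distD (stairs tau (k + l) s) _ _)).
apply: (le_trans (lerD H IH)).
rewrite exprS invfM mulrA divff ?pnatr_eq0// mul1r; lra.
Qed.

(* Among the four possible quarters, the next staircase climbs in the one that
   is visited least; the values outside [A] are common to all of [Q'], so [A]
   shrinks by a factor 4 while choosing common cells costs (k + 3) bits for each
   element of [A]. The exponents 2k + 5 absorb the sum of these costs. *)
Lemma stairs_pigeonhole_step (T I : finType) (v : T -> I -> R) (Q : {set T})
    (A : {set I}) (k : nat) :
  (forall t i, 0 <= v t i <= 1) ->
  (forall t t' i, t \in Q -> t' \in Q -> i \notin A -> v t i = v t' i) ->
  exists (r : 'I_4) (Q' : {set T}) (A' : {set I}),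
    [/\ Q' \subset Q, (#|Q| <= #|Q'| * 2 ^ ((k + 3) * #|A|))%N, (4 * #|A'| <= #|A|)%N,
      (forall t t' i, t \in Q' -> t' \in Q' -> i \notin A' ->
        stair (2 ^ k) r (v t i) = stair (2 ^ k) r (v t' i)) &
      (forall t t' i, t \in Q' -> t' \in Q' -> `|v t i - v t' i| <= 2%:R ^- k)].
Proof.
move=> v01 vA.
pose n := (2 ^ k)%N; have n0 : (0 < n)%N by rewrite expn_gt0.
pose cell t i := Num.truncn (4%:R * (n%:R * v t i)).
have cellP t i : (cell t i)%:R <= 4%:R * (n%:R * v t i) < (cell t i).+1%:R.
  by apply: truncn_itv; case/andP: (v01 t i) => *; rewrite !mulr_ge0.
have cell_lt t i : (cell t i < (4 * n).+1)%N.
  rewrite ltnS -(ler_nat R); case/andP: (cellP t i) => /le_trans + _; apply.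
  by rewrite natrM ler_pM2l// ler_piMr//; case/andP: (v01 t i).
(* The constant label outside [A] makes the number of labels depend on [#|A|] only. *)
pose lab t : {ffun I -> 'I_(4 * n).+1} := [ffun i => if i \in A then inord (cell t i) else ord0].
pose P := [set f | f \in pffun_on (ord0 : 'I_(4 * n).+1) (mem A) (mem 'I_(4 * n).+1)]%SET.
have [|Q' [Q'Q labQ' cardQ']] := @pigeonhole _ _ lab Q P.
  move=> t _; rewrite inE; apply/pffun_onP; split=> [|j _]; last by [].
  by apply/fintype.subsetP => i; rewrite inE ffunE; case: ifP => //; rewrite eqxx.
(* There are [4 * n + 1] cells, the last one for the value 1, and this is at most [2 ^ (k + 3)]. *)
have cardP : (#|P| <= 2 ^ ((k + 3) * #|A|))%N.
  rewrite cardsE card_pffun_on card_ord expnM.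
  have : ((4 * n).+1 <= 2 ^ (k + 3))%N by rewrite expnD -/n; lia.
  by case: #|A| => [//|a]; rewrite leq_exp2r.
have [t0 t0Q'|Q'0] := pickP (mem Q'); last first.
  have Q'e t : t \in Q' = false by exact: Q'0.
  exists ord0, Q', finset.set0; split; rewrite ?cards0 ?muln0//.
  - by rewrite (leq_trans cardQ')// leq_mul2l cardP orbT.
  - by move=> t t' i; rewrite Q'e.
  - by move=> t t' i; rewrite Q'e.
have cell_eq t i : t \in Q' -> i \in A -> cell t i = cell t0 i.
  move=> tQ iA; have /ffunP/(_ i) := labQ' _ _ tQ t0Q'.
  by rewrite !ffunE iA => /(congr1 val) /=; rewrite !inordK.
(* On [A] the whole of [Q'] shares the cells of [t0], so the least visited quarter can be read off
   [t0]. *)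
have [//|r|i r r'|r rA] :=
    @least_of_disjoint _ 4 (fun r => [set i in A | (cell t0 i %% 4 == r)%N]%SET) A.
- by apply/fintype.subsetP => i; rewrite inE => /andP[].
- by rewrite !inE => /andP[_ /eqP ir] /andP[_ /eqP ir']; apply: val_inj; rewrite /= -ir.
exists r, Q', [set i in A | (cell t0 i %% 4 == r)%N]%SET; split=> //.
- by rewrite (leq_trans cardQ')// leq_mul2l cardP orbT.
- move=> t t' i tQ t'Q; rewrite inE negb_and; have [iA|iA] /= := boolP (i \in A).
    move=> ir; apply: (@stair_const _ _ (cell t0 i)) => //.
    + by rewrite -(cell_eq t).
    + by rewrite -(cell_eq t').
  by move=> _; rewrite (vA t t')// (fintype.subsetP Q'Q).
move=> t t' i tQ t'Q; have [iA|iA] := boolP (i \in A); last first.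
  by rewrite (vA t t')// ?(fintype.subsetP Q'Q)// subrr normr0 invr_ge0 exprn_ge0.
have nR : 0 < n%:R :> R by rewrite ltr0n.
have := cellP t i; have := cellP t' i; rewrite !cell_eq// -natr1 => H H'.
have : `|n%:R * (v t i - v t' i)| <= 1 by rewrite ler_norml mulrBr; lra.
by rewrite normrM ger0_norm ?ler0n// -natrX -/n -ler_pdivlMl// mulr1.
Qed.

Lemma stairs_pigeonhole (T I : finType) (v : T -> I -> R) (Q : {set T})
    (A : {set I}) (k : nat) :
  (forall t i, 0 <= v t i <= 1) ->
  (forall t t' i, t \in Q -> t' \in Q -> i \notin A -> v t i = v t' i) ->
  exists (tau : nat -> 'I_4) (Q' : {set T}),
    [/\ Q' \subset Q, (#|Q| <= #|Q'| * 2 ^ (5 * #|A|))%N &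
      (forall t t' i, t \in Q' -> t' \in Q' ->
        `|stairs tau k (v t i) - stairs tau k (v t' i)| <= 2%:R ^- k)].
Proof.
move=> v01 vA.
(* [(2 * l + 5) * #|A'|] bits are reserved for the later stages: the next one spends
   [(l + 3) * #|A'|] of them and leaves a set at most a quarter as large. *)
have inv l : exists (tau : nat -> 'I_4) (Q' : {set T}) (A' : {set I}),
    [/\ Q' \subset Q, (#|Q| * 2 ^ ((2 * l + 5) * #|A'|) <= #|Q'| * 2 ^ (5 * #|A|))%N &
      (forall t t' i, t \in Q' -> t' \in Q' -> i \notin A' ->
        stairs tau l (v t i) = stairs tau l (v t' i))].
  elim: l => [|l [tau [Q1 [A1 [Q1Q cardQ1 eqA1]]]]].
    by exists (fun=> ord0), Q, A; split.
  have [||r [Q2 [A2 [Q2Q1 cardQ2 cardA2 eqA2 _]]]] :=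
    @stairs_pigeonhole_step T I (fun t i => stairs tau l (v t i)) Q1 A1 l.
  - by move=> t i; exact: stairs_itv.
  - exact: eqA1.
  pose tau' i := if i == l then r else tau i.
  have tauE : stairs tau l =1 stairs tau' l.
    by apply: eq_stairs => i il; rewrite /tau' ltn_eqF.
  exists tau', Q2, A2; split.
  - exact: fintype.subset_trans Q1Q.
  - rewrite -(leq_pmul2r (expn_gt0 2 ((l + 3) * #|A1|))) -mulnA -expnD.
    apply: (@leq_trans (#|Q1| * 2 ^ (5 * #|A|))%N).
    + apply: leq_trans cardQ1; rewrite leq_mul2l leq_exp2l//.
      apply/orP; right; nia.
    + by rewrite mulnAC leq_mul2r cardQ2 orbT.
  - by move=> t t' i tQ t'Q iA /=; rewrite -!tauE /tau' eqxx; exact: eqA2.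
have [tau [Q1 [A1 [Q1Q cardQ1 eqA1]]]] := inv k.
(* A last step is run for its closeness clause, without extending [tau]; the reserve [2 * k + 5]
   covers its price [k + 3]. *)
have [||r [Q2 [A2 [Q2Q1 cardQ2 cardA2 _ close]]]] :=
  @stairs_pigeonhole_step T I (fun t i => stairs tau k (v t i)) Q1 A1 k.
- by move=> t i; exact: stairs_itv.
- exact: eqA1.
exists tau, Q2; split=> //; first exact: fintype.subset_trans Q1Q.
rewrite -(leq_pmul2r (expn_gt0 2 ((k + 3) * #|A1|))).
apply: (@leq_trans (#|Q1| * 2 ^ (5 * #|A|))%N).
- by apply: leq_trans cardQ1; rewrite leq_mul2l leq_exp2l// leq_mul2r; apply/orP; right; lia.
- by rewrite mulnAC leq_mul2r cardQ2 orbT.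
Qed.

End Staircase.

(** * Devil's staircases as limits of staircases *)

Section Limit.
Context (R : realType).
Local Open Scope ring_scope.

Lemma clamp_id (s : R) : 0 <= s <= 1 -> clamp s = s.
Proof. by case/andP => s0 s1; rewrite /clamp (min_idPr s1); apply/max_idPr. Qed.

Lemma le_nat_truncn (x : R) (n : nat) : 0 <= x -> (Num.truncn x < n)%N -> x <= n%:R.
Proof.
move=> /truncn_itv/andP[_ /ltW xn] lt_n; apply: (le_trans xn).
by rewrite ler_nat.
Qed.

Lemma pow2_small (e : R) : 0 < e -> exists k, 2%:R ^- k < e.
Proof.
move=> e0; exists (Num.truncn e^-1).
rewrite -[e in X in _ < X]invrK ltf_pV2 ?posrE ?exprn_gt0 ?invr_gt0//.
have /andP[_] : (Num.truncn e^-1)%:R <= e^-1 < (Num.truncn e^-1).+1%:R.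
  by apply: truncn_itv; rewrite invr_ge0 ltW.
by move=> /lt_le_trans; apply; rewrite -natrX ler_nat ltn_expl.
Qed.

Lemma stairs_limit (tau : nat -> 'I_4) : exists theta : R -> R,
  [/\ continuous theta, theta 0 = 0, theta 1 = 1 &
    forall k s, 0 <= s <= 1 -> `|theta s - stairs tau k s| <= 2%:R * 2%:R ^- k].
Proof.
(* By the tail bound of [stairs_cauchy] each [b s k] lies below the limit, so the supremum is the
   limit, with an explicit error. [clamp] extends it to the whole line. *)
pose b s k := stairs tau k (clamp s) - 2%:R * 2%:R ^- k : R.
pose theta s := sup (range (b s)).
have pos k : 0 < 2%:R ^- k :> R by rewrite invr_gt0 exprn_gt0.
have close s k l : b s l <= stairs tau k (clamp s) + 2%:R * 2%:R ^- k.
  rewrite /b; have [kl|lk] := leqP k l.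
    have := @stairs_cauchy _ tau k (l - k) _ (clamp_itv s).
    by rewrite subnKC// ler_norml => /andP[_]; have := pos l; lra.
  have := @stairs_cauchy _ tau l (k - l) _ (clamp_itv s).
  by rewrite subnKC ?(ltnW lk)// ler_norml => /andP[+ _]; have := pos k; lra.
have thetaP s k : `|theta s - stairs tau k (clamp s)| <= 2%:R * 2%:R ^- k.
  rewrite ler_norml; apply/andP; split.
    suff : b s k <= theta s by rewrite /b; lra.
    apply: ub_le_sup; last by exists k.
    by exists (stairs tau k (clamp s) + 2%:R * 2%:R ^- k) => _ [l _ <-]; exact: close.
  suff : theta s <= stairs tau k (clamp s) + 2%:R * 2%:R ^- k by lra.
  apply: ge_sup => [|_ [l _ <-]]; last exact: close.
  by exists (b s 0%N), 0%N.
have thetaE s : 0 <= s <= 1 -> forall k, `|theta s - stairs tau k s| <= 2%:R * 2%:R ^- k.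
  by move=> s01 k; have := thetaP s k; rewrite clamp_id.
have fixed s : 0 <= s <= 1 -> (forall k, stairs tau k s = s) -> theta s = s.
  move=> s01 stairs_s; apply/eqP; rewrite -subr_eq0 -normr_le0 leNgt; apply/negP => pos'.
  have [k] := pow2_small (divr_gt0 pos' (ltr0n _ 2)).
  by have := thetaE s s01 k; rewrite stairs_s; lra.
exists theta; split; last by move=> k s s01; exact: thetaE.
  move=> s; apply/cvgrPdist_lt => e e0.
(* Two uniform errors [2 * 2 ^ -k < e / 3] leave [e / 3] for the continuity of stage [k]. *)
have [k ke] := pow2_small (divr_gt0 e0 (ltr0n _ 6)).
have cont : stairs tau k (clamp y) @[y --> s] --> stairs tau k (clamp s).
  apply: (@continuous_comp _ _ _ (@clamp R) (stairs tau k)); first exact: continuous_clamp.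
  exact: continuous_stairs.
have /cvgrPdist_lt/(_ (e / 3%:R)) := cont; rewrite divr_gt0// => /(_ isT).
apply: filterS => y; have := thetaP s k; have := thetaP y k.
rewrite !ler_norml !ltr_norml => /andP[? ?] /andP[? ?] /andP[? ?].
apply/andP; split; lra.
- by apply: fixed; rewrite ?lexx ?ler01// => k; exact: stairs0.
- by apply: fixed; rewrite ?lexx ?ler01// => k; exact: stairs1.
Qed.

End Limit.

(** * Itineraries near a point *)

Section Metric.
Context (R : realType) (X : metricType R).
Local Open Scope ring_scope.

Lemma nbhs_mdist (x : X) (P : X -> Prop) :
  (\forall z \near x, P z) <-> exists2 e, 0 < e & forall z, mdist x z < e -> P z.
Proof.
split=> [/nbhs_ballP[e /= e0 eP]|[e e0 eP]].
  by exists e => // z xz; apply: eP; rewrite ballEmdist.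
by apply/nbhs_ballP; exists e => // z; rewrite ballEmdist => /eP.
Qed.

Lemma continuous_mdist (x : X) : continuous (mdist x : X -> R).
Proof.
move=> y; apply/cvgrPdist_lt => e e0; apply/(nbhs_mdist y); exists e => // z yz.
have := metric_triangle x y z; have := metric_triangle x z y.
by rewrite (metric_sym z y) ltr_norml => *; apply/andP; split; lra.
Qed.

End Metric.

Section Annuli.
Context (R : realType) (X : metricType R) (G : groupType) (a : topological_action G X).
Local Open Scope ring_scope.
Implicit Types (x z : X) (S K : {fset G}).

(** For decreasing radii, values strictly between 0 and 1 occur only in shell number [j]; distinct
    [j] give disjoint shells. *)
Definition bump x (rad : nat -> R) (j : nat) z : R :=
  clamp ((mdist x z - rad j.+1) / (rad j - rad j.+1)).

Lemma continuous_bump x rad j : continuous (bump x rad j).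
Proof.
move=> z; apply: (@continuous_comp _ _ _
  (fun z => (mdist x z - rad j.+1) / (rad j - rad j.+1)) (@clamp R));
  last exact: continuous_clamp.
apply: cvgM; last exact: cvg_cst.
by apply: cvgB; [exact: continuous_mdist|exact: cvg_cst].
Qed.

(** Such radii let a visit to the inner ball predict the position at the [S]-translated times:
    elements fixing [x] keep the orbit in ball number [j], the others throw it out of all the
    balls. *)
Definition nested_radii x S (rad : nat -> R) : Prop :=
  [/\ forall j, 0 < rad j.+1 < rad j,
    forall s, s \in S -> a s x = x -> forall j z,
      mdist x z <= rad j.+1 -> mdist x (a s z) < rad j &
    forall s, s \in S -> a s x <> x -> forall z,
      mdist x z <= rad 0%N -> rad 0%N < mdist x (a s z)].

Lemma common_radius S (P : G -> R -> Prop) (r : R) : 0 < r ->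
  (forall s, s \in S -> exists2 e, 0 < e & forall e', 0 < e' <= e -> P s e') ->
  exists2 e, 0 < e <= r & forall s, s \in S -> P s e.
Proof.
move=> r0 SP.
suff [e e0 eP] : exists2 e, 0 < e & forall s, s \in S -> forall e', 0 < e' <= e -> P s e'.
  exists (Num.min e r); first by rewrite lt_min e0 r0 ge_min lexx orbT.
  by move=> s sS; apply: eP => //; rewrite lt_min e0 r0 ge_min lexx.
suff gen (l : seq G) : {subset l <= S} ->
    exists2 e, 0 < e & forall s, s \in l -> forall e', 0 < e' <= e -> P s e' by exact: (gen S).
elim: l => [_|s l IH sub]; first by exists 1.
have [|e e0 eP] := IH; first by move=> t tl; apply: sub; rewrite inE tl orbT.
have [d d0 dP] := SP s (sub _ (mem_head _ _)).
exists (Num.min d e); first by rewrite lt_min d0.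
move=> t; rewrite inE => /orP[/eqP->|tl] e'; rewrite le_min => /and3P[e'0 e'd e'e].
  by apply: dP; rewrite e'0.
by apply: (eP t) => //; rewrite e'0.
Qed.

(** Continuity at [x]: the elements that move [x] dictate the first radius, then those that fix [x]
    dictate each radius from the previous one. *)
Lemma exists_nested_radii x S (r : R) : 0 < r ->
  exists rad, nested_radii x S rad /\ rad 0%N <= r.
Proof.
move=> r0.
have near_act s (u : R) : mdist x (a s x) < u \/ u < mdist x (a s x) ->
    exists2 e, 0 < e & forall z, mdist x z < e ->
      (mdist x (a s x) < u -> mdist x (a s z) < u) /\
      (u < mdist x (a s x) -> u < mdist x (a s z)).
  move=> hu; apply/nbhs_mdist.
  have cont : mdist x (a s z) @[z --> x] --> mdist x (a s x).
    apply: (@continuous_comp _ _ _ (a s) (mdist x)); first exact: topact_continuous.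
    exact: continuous_mdist.
  have d0 : 0 < `|u - mdist x (a s x)|
    by rewrite normr_gt0 subr_eq0; case: hu => H; rewrite ?(gt_eqF H)// (lt_eqF H).
  have /cvgrPdist_lt/(_ _ d0) := cont; apply: filterS => z /=.
  case: hu => H.
    have /gtr0_norm -> : 0 < u - mdist x (a s x) by lra.
    by rewrite ltr_norml => /andP[? ?]; split; lra.
  have /ltr0_norm -> : u - mdist x (a s x) < 0 by lra.
  by rewrite ltr_norml => /andP[? ?]; split; lra.
have [e0 /andP[e0_gt0 e0r] e0P] : exists2 e, 0 < e <= r & forall s, s \in S ->
    a s x <> x -> forall z, mdist x z <= e -> e < mdist x (a s z).
  apply: common_radius => // s _; have [sx|/eqP sx] := pselect (a s x = x).
    by exists 1 => // e' _ /(_ sx).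
  have D0 : 0 < mdist x (a s x) by rewrite mdist_gt0 eq_sym.
  have [|e e0 eP] := near_act s (mdist x (a s x) / 2%:R); first by right; lra.
  exists (Num.min (e / 2%:R) (mdist x (a s x) / 2%:R)); first by rewrite lt_min !divr_gt0.
  move=> e'; rewrite le_min => /and3P[e'0 e'e e'D] _ z xz.
  have [|_ /(_ _)] := eP z; first lra.
  by move=> H; apply: le_lt_trans e'D _; apply: H; lra.
(* The condition [0 < u] stands under the existential so that [choice] yields a function on all of
   [R]. *)
have step (u : R) : exists v, 0 < u -> 0 < v < u /\ forall s, s \in S -> a s x = x ->
    forall z, mdist x z <= v -> mdist x (a s z) < u.
  have [u0|] := boolP (0 < u); last by exists 0.
  have [||v /andP[v0 vu] vP] := @common_radius S (fun s v => a s x = x ->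
    forall z, mdist x z <= v -> mdist x (a s z) < u) (u / 2%:R).
  - by rewrite divr_gt0.
  - move=> s _; have [sx|sx] := pselect (a s x = x); last by exists 1.
    have [|e e_gt0 eP] := near_act s u; first by left; rewrite sx mdistxx.
    exists (e / 2%:R) => [|e' /andP[e'0 e'e] _ z xz]; first by rewrite divr_gt0.
    by have [|+ _] := eP z; [lra|apply; rewrite sx mdistxx].
  by exists v => _; split=> //; apply/andP; split=> //; lra.
have [next nextP] := choice step.
have rad_gt0 j : 0 < iter j next e0.
  by elim: j => //= j IH; case: (nextP _ IH) => /andP[].
exists (fun j => iter j next e0); split=> //; split.
- by move=> j /=; case: (nextP _ (rad_gt0 j)).
- by move=> s sS sx j z; case: (nextP _ (rad_gt0 j)) => _ /(_ s sS sx z).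
- by move=> s sS sx z; exact: e0P.
Qed.

Lemma bump_itv x rad j z : 0 <= bump x rad j z <= 1.
Proof. exact: clamp_itv. Qed.

Lemma nested_radii_le x S rad j k : nested_radii x S rad -> (j <= k)%N -> rad k <= rad j.
Proof.
move=> [mono _ _]; elim: k => [|k IH]; first by rewrite leqn0 => /eqP->.
rewrite leq_eqVlt => /orP[/eqP->//|/IH]; apply: le_trans.
by case/andP: (mono k) => _ /ltW.
Qed.

Lemma bump_in x S rad j z : nested_radii x S rad -> mdist x z <= rad j.+1 -> bump x rad j z = 0.
Proof.
move=> [mono _ _] xz; apply: clamp_le0; rewrite pmulr_lle0 ?subr_le0//.
by rewrite invr_gt0 subr_gt0; case/andP: (mono j).
Qed.

Lemma bump_out x S rad j z : nested_radii x S rad -> rad j <= mdist x z -> bump x rad j z = 1.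
Proof.
move=> [mono _ _] xz; apply: clamp_ge1; rewrite ler_pdivlMr ?mul1r ?lerB//.
by rewrite subr_gt0; case/andP: (mono j).
Qed.

Section Pattern.
Variables (x : X) (K : {fset G}) (rad : nat -> R).
Let n := #|` K|.
Let S := [fset (s^-1 * s')%g | s in K, s' in K]%fset.
Hypothesis n_gt0 : (0 < n)%N.
Hypothesis radP : nested_radii x S rad.
Variables (E E' : {fset G}).
Hypothesis KE : forall s g, s \in K -> g \in E -> (s * g)%g \in E'.

Let annulus j z : {set E} := [set g : E | rad j.+1 < mdist x (a (val g) z) < rad j]%SET.

(* A time spent in the inner ball outside the annulus determines on which side
   of the annulus all its [S]-translates lie, hence a family of [K]-separated
   centers and the times spent in the annulus determine everything. *)
Lemma itinerary_code z : exists p : 'I_n * {set E},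
  [/\ (n * #|annulus p.1 z| <= #|` E|)%N, (n * #|p.2| <= #|` E'|)%N &
    forall g : E, g \notin annulus p.1 z -> bump x rad p.1 (a (val g) z) =
      (~~ `[< exists b s, [/\ b \in p.2, s \in S, a s x = x & val g = (s * val b)%g] >])%:R].
Proof.
(* The annuli are disjoint, so one of the [n] of them is visited during at most one [n]-th of the
   times. *)
have [//||i j j'|j jA] := @least_of_disjoint _ n (fun j => annulus j z) finset.setT.
- by move=> j; exact: finset.subsetT.
- rewrite !inE => /andP[ij ij2] /andP[ij' ij2']; apply: val_inj => /=.
  have [lt|gt|//] := ltngtP (val j) (val j'); exfalso.
    by have := nested_radii_le radP lt; have := lt_trans ij ij2'; lra.
  by have := nested_radii_le radP gt; have := lt_trans ij' ij2; lra.
pose inner := [set g : E | mdist x (a (val g) z) <= rad j.+1]%SET.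
have [B [Bin Bcard Bcov]] := @separated_centers G E val inner K val_inj.
exists (j, B); split=> /=.
- by rewrite (leq_trans jA)// cardsT cardfE.
- by apply: Bcard => g s sK; apply: KE => //; exact: valP.
move=> g gA; case: asboolP => [[b [s [bB sS sx gsb]]]|nb] /=.
  apply: (bump_in radP); move: gA; rewrite inE negb_and -!leNgt => /orP[//|jg].
  have := fintype.subsetP Bin b bB; rewrite inE => binn.
  have [_ /(_ s sS sx j (a (val b) z) binn) + _] := radP.
  by rewrite -topactM -gsb => /lt_le_trans/(_ jg); rewrite ltxx.
apply: (bump_out radP); move: gA; rewrite inE negb_and -!leNgt => /orP[ginn|//].
have [||b [s [s' [bB sK s'K gb]]]] := Bcov g; first by rewrite inE.
  by move=> K0; move: n_gt0; rewrite /n K0 cardfs0.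
have sS : (s^-1 * s')%g \in S by apply/imfset2P; exists s => //; exists s'.
have [sx|sx] := pselect (a (s^-1 * s')%g x = x).
  by exfalso; apply: nb; exists b, (s^-1 * s')%g; rewrite -mulgA.
have bin : mdist x (a (val b) z) <= rad 0%N.
  have := fintype.subsetP Bin b bB; rewrite inE => /le_trans; apply.
  exact: nested_radii_le radP _.
(* If [s^-1 * s'] moves [x], the position at time [g] is beyond the largest radius, which gives the
   goal. *)
have [_ _ /(_ _ sS sx _ bin)] := radP; rewrite -topactM -mulgA -gb => /ltW.
by apply: le_trans; exact: nested_radii_le radP _.
Qed.

End Pattern.

End Annuli.

Section Pattern.
Context (R : realType) (X : metricType R) (G : groupType) (a : topological_action G X).
Local Open Scope ring_scope.
Variables (x : X) (K : {fset G}) (rad : nat -> R).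
Let n := #|` K|.
Let S := [fset (s^-1 * s')%g | s in K, s' in K]%fset.
Hypothesis n_gt0 : (0 < n)%N.
Hypothesis radP : nested_radii a x S rad.
Variables (E E' : {fset G}).
Hypothesis KE : forall s g, s \in K -> g \in E -> (s * g)%g \in E'.
Hypothesis EE' : (#|` E| <= #|` E'|)%N.
Let m := (#|` E'| %/ n)%N.
Let few := #|[set B : {set E} | (#|B| <= m)%N]%SET|.

(** A first pigeonhole on the codes and the annulus times, with [n * few ^ 2] labels, makes the
    bumps agree off a common set of at most [m] times. The staircases settle this set at the price
    [2 ^ (5 * m)]. *)
Lemma itinerary_pigeonhole (T : finType) (xs : T -> X) (Q : {set T}) k :
  exists (j : 'I_n) (tau : nat -> 'I_4) (Q' : {set T}),
    [/\ Q' \subset Q, (#|Q| <= #|Q'| * (n * few ^ 2 * 2 ^ (5 * m)))%N &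
      forall t t' g, t \in Q' -> t' \in Q' -> g \in E ->
        `|stairs tau k (bump x rad j (a g (xs t))) - stairs tau k (bump x rad j (a g (xs t')))|
          <= 2%:R ^- k].
Proof.
have [code codeP] := choice (itinerary_code n_gt0 radP KE).
pose ann (t : T) := [set g : E | rad (code (xs t)).1.+1 < mdist x (a (val g) (xs t))
  < rad (code (xs t)).1]%SET.
pose lab t := (code (xs t), ann t).
pose F := [set B : {set E} | (#|B| <= m)%N]%SET.
have mP c : (n * c <= #|` E'|)%N -> (c <= m)%N by rewrite /m leq_divRL// mulnC.
have [|Q1 [Q1Q labQ1 cardQ1]] := @pigeonhole _ _ lab Q (finset.setX (finset.setX finset.setT F) F).
  move=> t _; rewrite !inE /=; case: (codeP (xs t)) => cA cB _.
  by rewrite !mP// (leq_trans cA).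
rewrite !cardsX cardsT card_ord -/few in cardQ1.
have [t0 t0Q1|Q10] := pickP (mem Q1); last first.
  have Q1e t : t \in Q1 = false by exact: Q10.
  exists (Ordinal n_gt0), (fun=> ord0), Q1; split=> //.
    by rewrite (leq_trans cardQ1)// leq_mul2l; apply/orP; right; rewrite mulnA leq_pmulr ?expn_gt0.
  by move=> t t' g; rewrite Q1e.
have annC t : (#|ann t| <= m)%N.
  by case: (codeP (xs t)) => cA _ _; apply: mP; rewrite (leq_trans cA).
pose j := (code (xs t0)).1.
have same t : t \in Q1 -> code (xs t) = code (xs t0) /\ ann t = ann t0.
  by move=> tQ; have [] := labQ1 t t0 tQ t0Q1.
have [||tau [Q2 [Q2Q1 cardQ2 close]]] :=
  @stairs_pigeonhole R T E (fun t g => bump x rad j (a (val g) (xs t))) Q1 (ann t0) k.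
- by move=> t g; exact: bump_itv.
- move=> t t' g tQ t'Q gA.
  have [ct at_] := same t tQ; have [ct' at'] := same t' t'Q.
  have [_ _ /(_ g)] := codeP (xs t); have [_ _ /(_ g)] := codeP (xs t').
  by rewrite -/(ann t) -/(ann t') at_ at' ct ct' => -> // ->.
exists j, tau, Q2; split.
- exact: fintype.subset_trans Q1Q.
- have two5 : (2 ^ (5 * #|ann t0|) <= 2 ^ (5 * m))%N by rewrite leq_exp2l// leq_mul2l annC orbT.
  apply: (leq_trans cardQ1); apply: (leq_trans (leq_mul cardQ2 (leqnn _))).
  rewrite -mulnA leq_mul2l; apply/orP; right; rewrite mulnC -mulnn mulnA.
  by rewrite leq_mul2l two5 orbT.
- by move=> t t' g tQ t'Q gE; exact: (close t t' [` gE]%fset).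
Qed.

End Pattern.

(** * Entropy of the code *)

Section Loss.
Context (R : realType).
Local Open Scope ring_scope.

Lemma natr_expR_ln (n : nat) : (0 < n)%N -> n%:R = expR (ln n%:R) :> R.
Proof. by move=> n0; rewrite lnK// posrE ltr0n. Qed.

(** After division, [card_bounded_subsets] reads [n ^ m * (1 + 1 / n) ^ #|I|], and
    [1 + 1 / n <= expR (1 / n)]. *)
Lemma bounded_subsets_expR (I : finType) (m n : nat) : (0 < n)%N -> (m <= #|I|)%N ->
  #|[set B : {set I} | (#|B| <= m)%N]%SET|%:R <=
    expR (m%:R * ln (n%:R : R) + #|I|%:R / n%:R) :> R.
Proof.
move=> n0 mI; have nR : 0 < n%:R :> R by rewrite ltr0n.
have := @card_bounded_subsets I m n n0 mI; set c := #|_| => cI.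
rewrite -(ler_pM2r (exprn_gt0 #|I| nR)).
apply: (@le_trans _ _ (n.+1%:R ^+ #|I| * n%:R ^+ m)).
  rewrite -{1}(subnK mI) exprD mulrA ler_pM2r ?exprn_gt0//.
  by rewrite -!natrX -natrM ler_nat.
rewrite expRD expRM_natl -natr_expR_ln// -mulrA mulrC ler_pM2l ?exprn_gt0//.
rewrite expRM_natl -exprMn; apply: lerXn2r; rewrite ?nnegrE ?mulr_ge0 ?expR_ge0 ?ler0n//.
have -> : n.+1%:R = (1 + n%:R^-1) * n%:R :> R.
  by rewrite mulrDl mul1r mulVf ?gt_eqF// natr1.
by rewrite ler_pM2r// expR_ge1Dx.
Qed.

(** The logarithm of the loss is at most [ln n + (4 * ln n + 14) * e / n]. Each summand gets half of
    [c * e]: the second by taking [n] large, the first by then taking [e] large. *)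
Lemma coding_loss (c : R) : 0 < c -> exists n0 : nat, forall n, (n0 <= n)%N ->
  exists L : nat, forall (I : finType) (e e' : nat), (L <= e <= #|I|)%N ->
    (#|I| <= 2 * e)%N -> (e' <= 2 * e)%N ->
    (n * #|[set B : {set I} | (#|B| <= e' %/ n)%N]%SET| ^ 2 * 2 ^ (5 * (e' %/ n)))%:R
      <= expR (c * e%:R) :> R.
Proof.
(* With [s] the square root of [n], [ln n <= 2 * s] gives [4 * ln n + 14 <= 22 * s], and
   [22 * s / n <= c / 2] amounts to [44 / c <= s]. *)
move=> c0; exists (Num.truncn ((44%:R / c) ^+ 2)).+2 => n n0n.
have n0 : (1 < n)%N by lia.
have nR : 0 < n%:R :> R by rewrite ltr0n ltnW.
pose s := Num.sqrt n%:R : R.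
have ss : s ^+ 2 = n%:R by rewrite sqr_sqrtr// ltW.
have s_gt0 : 0 < s by rewrite sqrtr_gt0.
have s1 : 1 <= s by rewrite -sqrtr1 ler_sqrt// ler1n ltnW.
have sc : 44%:R / c <= s.
  rewrite -(@ler_pXn2r _ 2)// ?nnegrE ?divr_ge0 ?(ltW c0) ?(ltW s_gt0)// ss.
  by apply: le_nat_truncn; [rewrite sqr_ge0|exact: ltnW].
have lnn : 0 <= ln (n%:R : R) <= 2%:R * s.
  apply/andP; split; first by apply: ln_ge0; rewrite ler1n ltnW.
  by rewrite -ss lnXn// mulr_natl ler_wMn2r// ltW// ln_sublinear.
(* This [L] ensures [ln n <= 2 * s <= c / 2 * e]. *)
exists (Num.truncn (4%:R * s / c)).+1 => I e e' /andP[Le eI] I2e e'2e.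
have eR : 4%:R * s / c <= e%:R.
  by apply: le_nat_truncn => //; rewrite divr_ge0// ltW// mulr_gt0.
set m := (e' %/ n)%N.
have mI : (m <= #|I|)%N.
  apply: leq_trans eI; rewrite -(leq_pmul2r (ltnW n0)) (leq_trans (leq_divM _ _))//.
  by rewrite (leq_trans e'2e)// mulnC leq_mul2l n0 orbT.
have mR : m%:R <= 2%:R * e%:R / n%:R :> R.
  rewrite ler_pdivlMr// -!natrM ler_nat (leq_trans (leq_divM _ _))//.
have few := @bounded_subsets_expR I m n (ltnW n0) mI.
set f := #|_| in few *.
have two : 2%:R <= expR 1 :> R by have := @expR_ge1Dx R 1; rewrite -(natrD _ 1 1).
rewrite !natrM !natrX.
apply: (@le_trans _ _ (expR (ln (n%:R : R)) *
  expR (m%:R * ln (n%:R : R) + #|I|%:R / n%:R) ^+ 2 * expR 1 ^+ (5 * m))).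
  rewrite -natr_expR_ln ?(ltnW n0)//.
  apply: ler_pM; rewrite ?mulr_ge0 ?exprn_ge0 ?ler0n//.
    by rewrite ler_pM2l// -expr2; apply: lerXn2r; rewrite ?nnegrE ?ler0n ?expR_ge0.
  by apply: lerXn2r; rewrite ?nnegrE ?ler0n ?expR_ge0.
rewrite -!expRM_natl -!expRD ler_expR mulr1 natrM.
have IR : #|I|%:R / n%:R <= 2%:R * e%:R / n%:R :> R.
  by rewrite ler_pM2r ?invr_gt0// -natrM ler_nat.
have mln : m%:R * ln (n%:R : R) <= 2%:R * e%:R / n%:R * (2%:R * s).
  by apply: ler_pM => //; case/andP: lnn.
have lns : ln (n%:R : R) <= c / 2%:R * e%:R.
  case/andP: lnn => _ /le_trans; apply.
  by move: eR; rewrite ler_pdivrMr//; lra.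
have e1 : e%:R / n%:R * (8%:R * s + 14%:R) <= c / 2%:R * e%:R.
  rewrite -mulrA mulrC ler_wpM2r//.
  rewrite mulrC ler_pdivrMr// -ss.
  by move: sc; rewrite ler_pdivrMr//; nra.
lra.
Qed.
End Loss.

(** * Folner sets and covers *)

Section Folner.
Context (G : groupType).
Local Open Scope ring_scope.
Implicit Types (E F K T : {fset G}) (e : rat).

Lemma folner_invariantW K K' e e' E : (K' `<=` K)%fset -> e <= e' ->
  folner_invariant K e E -> folner_invariant K' e' E.
Proof.
move=> /fsubsetP K'K ee' [E0 KE]; split=> // s /K'K/KE /= /le_trans; apply.
by rewrite ler_wpM2r.
Qed.

Lemma folner_filterI (S S' : set {fset G}) :
  folner_filter G S -> folner_filter G S' -> folner_filter G (S `&` S').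
Proof.
move=> [[K e] /= e0 KS] [[K' e'] /= e'0 KS'].
exists ((K `|` K')%fset, Num.min e e') => /=; first by rewrite lt_min e0.
move=> E inv; split.
- by apply: KS; apply: folner_invariantW inv; rewrite ?fsubsetUl// ge_min lexx.
- by apply: KS'; apply: folner_invariantW inv; rewrite ?fsubsetUr// ge_min lexx orbT.
Qed.

Definition fset_prod T E : {fset G} := [fset (s * g)%g | s in T, g in E]%fset.

Lemma fset_prodP T E s g : s \in T -> g \in E -> (s * g)%g \in fset_prod T E.
Proof. by move=> sT gE; apply/imfset2P; exists s => //; exists g. Qed.

(** The product of [T] and [E] adds to [E] only the parts of the translates [s E] outside [E]. The
    tolerance, the inverse of one more than the size of [T], keeps their total size below that of
    [E]. *)
Lemma folner_expand T : folner_filter G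
  [set E | E <> fset0 /\ (#|` fset_prod T E| <= 2 * #|` E|)%N].
Proof.
exists (T, (#|` T|.+1)%:R^-1) => /=; first by rewrite invr_gt0.
move=> E [E0 TE]; split=> //.
pose new s := ([fset (s * x)%g | x in E] `\` E)%fset.
have sub : (fset_prod T E `<=` E `|` \big[fsetU/fset0]_(s <- T) new s)%fset.
  apply/fsubsetP => _ /imfset2P[s sT [g gE ->]].
  have [sgE|sgE] := boolP ((s * g)%g \in E); rewrite inE ?sgE//=; apply/orP; right.
  apply/bigfcupP; exists s; first by rewrite sT.
  by rewrite !inE sgE; apply/imfsetP; exists g.
have card_new : (#|` \big[fsetU/fset0]_(s <- T) new s| <= \sum_(s <- T) #|` new s|)%N.
  elim/big_rec2: _ => [|s n F _ le]; first by rewrite cardfs0.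
  by rewrite (leq_trans (leq_card_fsetU _ _))// leq_add2l.
apply: leq_trans (fsubset_leq_card sub) _.
apply: (leq_trans (leq_card_fsetU _ _)); rewrite mul2n -addnn leq_add2l.
apply: (leq_trans card_new); rewrite -(leq_pmul2r (ltn0Sn #|` T|)) big_distrl /=.
apply: (@leq_trans (\sum_(s <- T) #|` E|)%N); last first.
  by rewrite big_const_seq count_predT iter_addn_0 leq_mul2l leqnSn orbT.
rewrite big_seq [X in (_ <= X)%N]big_seq; apply: leq_sum => s sT.
have := TE s sT => /=; rewrite mulrC ler_pdivlMr// -natrM ler_nat.
by apply: leq_trans; rewrite leq_mul2r; apply/orP; right; rewrite fsubset_leq_card// fsubsetUl.
Qed.

End Folner.

Section Covers.
Context (R : realType).
Local Open Scope ring_scope.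

Lemma subcover_number_le (X : Type) (U : set (set X)) (W : {fset set X}) :
  [set` W] `<=` U -> \bigcup_(V in [set` W]) V = [set: X] ->
  subcover_number R U <= #|` W|%:R.
Proof.
move=> WU WX; apply: ge_inf; first by exists 0 => _ [n _ <-]; exact: ler0n.
by exists #|` W| => //; exists [set` W]; split=> //; exact/card_eq_fsetP.
Qed.

(** The finite subcover rules out the default infimum 0 of an empty set; the point [x] rules out the
    empty subcover. *)
Lemma subcover_number_ge1 (X : Type) (x : X) (U : set (set X)) (W : {fset set X}) :
  [set` W] `<=` U -> \bigcup_(V in [set` W]) V = [set: X] ->
  1 <= subcover_number R U.
Proof.
move=> WU WX; apply: lb_le_inf.
  by exists #|` W|%:R, #|` W| => //; exists [set` W]; split=> //; exact/card_eq_fsetP.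
move=> _ [n [W' [_ W'X W'n]] <-]; rewrite ler1n lt0n; apply/eqP => n0.
have [V W'V _] : (\bigcup_(V in W') V) x by rewrite W'X.
have : (W' #= @set0 nat)%card by rewrite -II0 -n0.
by rewrite card_eq0 => /eqP W'0; move: W'V; rewrite W'0.
Qed.

(** Compactness in near-covering form, along the filter of finite subfamilies of [U] ordered by
    inclusion. *)
Lemma finite_subcover (X : topologicalType) (U : set (set X)) :
  compact [set: X] -> open_cover U ->
  exists W : {fset set X}, [set` W] `<=` U /\ \bigcup_(V in [set` W]) V = [set: X].
Proof.
move=> /compact_near_coveringP Xc [Uop UX].
pose F := filter_from [set W : {fset set X} | [set` W] `<=` U]
  (fun W => [set W' : {fset set X} | (W `<=` W')%fset]).
have FF : Filter F.
  apply: filter_from_filter; first by exists fset0 => V.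
  move=> W W' WU W'U; exists (W `|` W')%fset => [V|W2].
    by rewrite /= in_fsetU => /orP[/WU|/W'U].
  by rewrite /= fsubUset => /andP.
pose P (W : {fset set X}) x := exists2 V, V \in W & V x.
have [|W WU WP] := Xc _ F P FF.
  move=> x _; have [V UV Vx] : (\bigcup_(V in U) V) x by rewrite UX.
  exists (V, [set W : {fset set X} | ([fset V] `<=` W)%fset]) => /=.
    split; first by apply: open_nbhs_nbhs; split=> //; exact: Uop.
    by exists [fset V]%fset => // V' /=; rewrite inE => /eqP->.
  by move=> [z W] /= [Vz]; rewrite fsub1set => VW; exists V.
exists W; split=> //; apply/seteqP; split=> // x _.
by have [V VW Vx] := WP W (fsubset_refl W) x I; exists V.
Qed.

Lemma exists_subcover (X : topologicalType) (U : set (set X)) (e : R) :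
  compact [set: X] -> open_cover U -> 0 < e ->
  exists W : {fset set X}, [/\ [set` W] `<=` U, \bigcup_(V in [set` W]) V = [set: X] &
    #|` W|%:R < subcover_number R U + e].
Proof.
move=> Xc Uop e0; have [W0 [W0U W0X]] := finite_subcover Xc Uop.
pose A : set R := [set n%:R | n in [set n : nat | exists W : set (set X),
    [/\ W `<=` U, \bigcup_(V in W) V = [set: X] & (W #= `I_n)%card]]].
have hA : has_inf A.
  split; last by exists 0 => _ [n _ <-]; exact: ler0n.
  by exists #|` W0|%:R, #|` W0| => //; exists [set` W0]; split=> //; exact/card_eq_fsetP.
have [_ [n [W [WU WX Wn]] <-] nlt] := inf_adherent e0 hA.
have Wfin : finite_set W by apply/finite_setP; exists n.
exists (fset_set W); rewrite fset_setK//; split=> //.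
by rewrite (card_fset_set Wn).
Qed.

(** Near-covering compactness along the filter of small positive radii makes the local radius
    uniform. *)
Lemma lebesgue_number (X : metricType R) (U : set (set X)) :
  compact [set: X] -> open_cover U ->
  exists2 d : R, 0 < d & forall x, exists2 V, U V & forall y, mdist x y < d -> V y.
Proof.
move=> /compact_near_coveringP Xc [Uop UX].
pose good d x := exists2 V, U V & forall y, mdist x y < d -> V y.
have good_near (x : X) : \forall z \near x & d \near (0 : R)^'+, good d z.
  have [V UV Vx] : (\bigcup_(V in U) V) x by rewrite UX.
  have : \forall z \near x, V z by apply: open_nbhs_nbhs; split=> //; exact: Uop.
  move=> /nbhs_mdist[e e0 eV].
  exists ([set z | mdist x z < e / 2%:R], [set d | d < e / 2%:R]).
    split=> /=.
      by apply/(nbhs_mdist x (fun z => mdist x z < e / 2%:R)); exists (e / 2%:R) => //; lra.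
    by apply: nbhs_right_lt; lra.
  move=> [z d] /= [xz de]; exists V => // y zy; apply: eV.
  by have := metric_triangle x z y; lra.
have goodT := Xc R (0 : R)^'+ good _ (fun x _ => good_near x).
have [d [d0 dgood]] := filter_ex (filterI (nbhs_right_gt (0 : R)) (goodT _)).
by exists d => // x; exact: dgood.
Qed.

Lemma open_cover_join (G : groupType) (X : topologicalType) (a : topological_action G X)
    (U : set (set X)) (E : {fset G}) :
  open_cover U -> open_cover (cover_join a U E).
Proof.
move=> [Uop UX]; split=> [_ [V UV ->]|].
  rewrite openE => x Vx; apply: filter_bigI => s sE; apply: (topact_continuous (t := a)).
  by apply: open_nbhs_nbhs; split; [exact/Uop/UV|exact: Vx].
apply/seteqP; split=> // x _.
have cov s : exists V, U V /\ V (a s x).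
  by have [V UV Vx] : (\bigcup_(V in U) V) (a s x) by [rewrite UX]; exists V.
have [V VP] := choice cov.
exists (\bigcap_(s in [set` E]) (a s @^-1` V s)); last by move=> s _; case: (VP s).
by exists V => // s _; case: (VP s).
Qed.

Lemma separated_points (G : groupType) (X : metricType R) (a : topological_action G X)
    (U : set (set X)) (d : R) (E : {fset G}) (M : nat) :
  (forall x, exists2 V, U V & forall y, mdist x y < d -> V y) ->
  M%:R <= subcover_number R (cover_join a U E) ->
  exists xs : 'I_M -> X, forall i j, i != j ->
    exists2 g, g \in E & d <= mdist (a g (xs i)) (a g (xs j)).
Proof.
move=> dU MN.
pose sep x y := `[< exists2 g, g \in E & d <= mdist (a g x) (a g y) >].
have sepC x y : sep x y = sep y x.
  by apply/asboolP/asboolP => -[g gE dxy]; exists g; rewrite // metric_sym.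
suff [s sizes seps] : exists2 s : seq X, size s = M & pairwise sep s.
  exists (fun i => tnth (in_tuple s) (cast_ord (esym sizes) i)) => i j ij.
  apply/asboolP; rewrite -/(sep _ _).
  have [x0 _] : exists x0 : X, True by exists (tnth (in_tuple s) (cast_ord (esym sizes) i)).
  rewrite !(tnth_nth x0) /=.
  move/(pairwiseP x0) : seps => seps.
  have [lt|gt|e] := ltngtP (val i) (val j).
  - by apply: seps; rewrite ?inE ?sizes.
  - by rewrite sepC; apply: seps; rewrite ?inE ?sizes.
  - by rewrite (val_inj e) eqxx in ij.
suff H m : (m <= M)%N -> exists2 s : seq X, size s = m & pairwise sep s by exact: H.
elim: m => [_|m IH mM]; first by exists [::].
have [s sizes seps] := IH (ltnW mM).
suff [x xs] : exists x, all (sep x) s by exists (x :: s); rewrite /= ?sizes ?xs.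
apply: contrapT => nox.
have bowen y : exists W, cover_join a U E W /\ forall x, ~~ sep x y -> W x.
  have lebV g : exists V, U V /\ forall z, mdist (a g y) z < d -> V z.
    by have [V UV VP] := dU (a g y); exists V.
  have [V VP] := choice lebV.
  exists (\bigcap_(g in [set` E]) (a g @^-1` V g)); split.
    by exists V => // g _; case: (VP g).
  move=> x /asboolPn nsep g gE; have [_] := VP g; apply.
  rewrite ltNge; apply/negP => dxy; apply: nsep; exists g => //.
  by rewrite metric_sym.
have [w wP] := choice bowen.
have : subcover_number R (cover_join a U E) <= #|` [fset w y | y in s]%fset|%:R.
  apply: subcover_number_le => [V /= /imfsetP[y _ ->]|]; first by case: (wP y).
  apply/seteqP; split=> // x _.
  have /allPn[y ys nsep] : ~~ all (sep x) s by apply/negP => xs; apply: nox; exists x.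
  by exists (w y); [apply/imfsetP; exists y|have [_] := wP y; apply].
move/(le_trans MN); rewrite ler_nat leqNgt => /negP; apply.
apply: leq_ltn_trans (leq_imfset_card _ _ _) _.
by apply: leq_ltn_trans (size_undup s) _; rewrite sizes; exact: mM.
Qed.

End Covers.

(** * Orbits with close itineraries *)

Section EntropyGap.
Context (R : realType) (G : groupType) (X Y : metricType R).
Local Open Scope ring_scope.
Variables (a : topological_action G X) (b : topological_action G Y) (pi : X -> Y).
Hypothesis G_infinite : infinite_set [set: G].
Hypotheses (Xc : compact [set: X]) (Yc : compact [set: Y]).
Hypothesis pi_factor : factor_map a b pi.
Variables (U : set (set X)) (alpha beta d : R).
Hypothesis Uop : open_cover U.
Hypothesis alpha_beta : alpha < beta.
Hypothesis dU : forall x, exists2 V, U V & forall y, mdist x y < d -> V y.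
Hypothesis X_large : forall S, folner_filter G S ->
  exists2 E, S E & beta < ln (subcover_number R (cover_join a U E)) / #|` E|%:R.
Hypothesis Y_small : forall C, open_cover C -> exists2 S, folner_filter G S &
  forall E, S E -> ln (subcover_number R (cover_join b C E)) / #|` E|%:R <= alpha.

Definition small_cover (e : R) : set (set Y) := [set (ball y e)° | y in [set: Y]].

Lemma open_small_cover e : 0 < e -> open_cover (small_cover e).
Proof.
move=> e0; split=> [_ [y _ <-]|]; first exact: open_interior.
by apply/seteqP; split=> // y _; exists (ball y e)°; [exists y|exact: nbhsx_ballx].
Qed.

Definition quotients (K : {fset G}) : {fset G} := [fset (s^-1 * s')%g | s in K, s' in K]%fset.

(** [K] depends only on the entropy gap, so the radii can be fixed before [F], [k] and [e]. The pair
    comes from counting: the orbits separated over a Folner set [E0] outnumber the combinations of a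
    label in [Y] and a code. *)
Lemma close_itineraries : exists2 K : {fset G}, (0 < #|` K|)%N &
  forall x0 rad, nested_radii a x0 (quotients K) rad ->
  forall (F : {fset G}) k e, 0 < e ->
  exists (j : 'I_#|` K|) (tau : nat -> 'I_4) x x', [/\ d <= mdist x x',
    mdist (pi x) (pi x') < e &
    forall g, g \in F -> `|stairs tau k (bump x0 rad j (a g x)) -
      stairs tau k (bump x0 rad j (a g x'))| <= 2%:R ^- k].
Proof.
(* Half of the gap pays for the code, the other half for constant factors. *)
pose c := (beta - alpha) / 2%:R.
have c0 : 0 < c by rewrite divr_gt0// subr_gt0.
have [n0 lossP] := coding_loss c0.
have [K _ Kn0] := infinite_set_fset (maxn 1 n0) G_infinite.
move: Kn0; rewrite geq_max => /andP[K0 Kn0].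
have {lossP}[L lossP] := lossP _ Kn0.
exists K => // x0 rad radP F k e e0.
(* [Z] forces [E0] to be large: a translate of [Z] lies in [E'], which is at most twice as large as
   [E0]. *)
have [Z _ ZL] := infinite_set_fset (2 * maxn L (Num.truncn (2%:R / c)).+1) G_infinite.
pose F' := (1%g |` F)%fset.
(* With this [T], the set [E'] contains [E] and its translates by [K], yet has at most twice the
   size of [E0]. *)
pose T := (fset_prod K F' `|` F' `|` Z)%fset.
have [S1 S1fol S1P] := Y_small (open_small_cover (divr_gt0 e0 (ltr0n _ 2))).
have [E0 [[E0n0 TE0] /S1P YE0] XE0] := X_large (folner_filterI (folner_expand T) S1fol).
pose E := fset_prod F' E0.
pose E' := fset_prod T E0.
have F1 : 1%g \in F' by rewrite in_fset1U eqxx.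
have E0E : (E0 `<=` E)%fset.
  by apply/fsubsetP => g gE; rewrite -[g]mul1g; exact: fset_prodP.
have EE' : (E `<=` E')%fset.
  apply/fsubsetP => _ /imfset2P[s sF [g gE ->]].
  by apply: fset_prodP; rewrite // 2!in_fsetU sF orbT.
have KE s g : s \in K -> g \in E -> (s * g)%g \in E'.
  move=> sK /imfset2P[f fF [h hE ->]]; rewrite mulgA; apply: fset_prodP => //.
  by rewrite in_fsetU in_fsetU fset_prodP.
have ZE : (#|` Z| <= #|` E'|)%N.
  have /fset0Pn[g gE0] : E0 != fset0 by exact/eqP.
  have <- : #|` [fset (z * g)%g | z in Z]%fset| = #|` Z| by rewrite card_imfset//; exact: mulIg.
  apply: fsubset_leq_card; apply/fsubsetP => _ /imfsetP[s sZ ->].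
  by apply: fset_prodP => //; rewrite in_fsetU sZ orbT.
have E'2 : (#|` E'| <= 2 * #|` E0|)%N by [].
have cE0 := fsubset_leq_card E0E; have cE := fsubset_leq_card EE'.
have E0L : (L <= #|` E0|)%N by lia.
have E0c : ((Num.truncn (2%:R / c)).+1 <= #|` E0|)%N by lia.
have E0_gt0 : 0 < #|` E0|%:R :> R by rewrite ltr0n; lia.
have cE0R : 2%:R <= c * #|` E0|%:R.
  rewrite mulrC -ler_pdivrMr//.
  by apply: le_nat_truncn => //; rewrite divr_ge0// ltW.
have UE := open_cover_join a E0 Uop.
have CE := open_cover_join b E0 (open_small_cover (divr_gt0 e0 (ltr0n _ 2))).
move: XE0 YE0.
set NX := subcover_number R (cover_join a U E0); set NY := subcover_number R (cover_join b _ E0).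
have NX1 : 1 <= NX.
  by have [W [WU WX]] := finite_subcover Xc UE; exact: subcover_number_ge1 x0 _ _ WU WX.
have NY1 : 1 <= NY.
  by have [W [WC WY]] := finite_subcover Yc CE; exact: subcover_number_ge1 (pi x0) _ _ WC WY.
rewrite ltr_pdivlMr// ler_pdivrMr// => XE0 YE0.
have NXlt : expR (beta * #|` E0|%:R) < NX.
  by rewrite -ltr_ln ?posrE ?expR_gt0 ?expRK//; apply: lt_le_trans NX1.
have NYle : NY <= expR (alpha * #|` E0|%:R).
  by rewrite -ler_ln ?posrE ?expR_gt0 ?expRK//; apply: lt_le_trans NY1.
pose M := Num.truncn NX.
have /andP[MX XM] : M%:R <= NX < M.+1%:R by apply: truncn_itv; apply: le_trans NX1.
have X2M : NX <= 2%:R * M%:R.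
  have : (0 < M)%N by rewrite -ltnS -(ltr_nat R); apply: le_lt_trans XM.
  by rewrite -(ler_nat R) => M1; move: XM; rewrite -natr1; lra.
have [xs xsP] := separated_points dU MX.
have [W [WC WY Wlt]] := exists_subcover Yc CE (@ltr01 R).
have [lab labP] : exists lab : 'I_M -> W, forall t, val (lab t) (pi (xs t)).
  suff /choice[lab labP] : forall t, exists V : W, val V (pi (xs t)) by exists lab.
  move=> t; have [V VW Vx] : (\bigcup_(V in [set` W]) V) (pi (xs t)) by rewrite WY.
  by exists [` VW]%fset.
have [//|Q1 [_ labQ1]] := @pigeonhole _ _ lab finset.setT finset.setT.
rewrite !cardsT card_ord -cardfE => cardQ1.
have [j [tau [Q2 [Q2Q1 cardQ2 close]]]] :=
  @itinerary_pigeonhole _ _ _ a x0 K rad K0 radP E E' KE cE _ xs Q1 k.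
(* Otherwise [M] is at most the loss times the size of [W]. As [NX <= 2 * M] and [W] has at most
   [2 * expR (alpha * N)] members, [N] being the size of [E0], this bounds [NX] by
   [4 * expR ((c + alpha) * N)], hence by [expR (beta * N)], against [NXlt]. *)
have Q2_gt1 : (1 < #|Q2|)%N.
  rewrite ltnNge; apply/negP => Q2le1.
  have := @lossP E #|` E0| #|` E'|; rewrite -cardfE E0L cE0 => /(_ isT).
  have E2 : (#|` E| <= 2 * #|` E0|)%N by apply: leq_trans cE _.
  move=> /(_ E2 E'2); set loss := (_ * _ * _)%N in cardQ2 *; move=> lossle.
  have : (M <= loss * #|` W|)%N.
    rewrite (leq_trans cardQ1)// leq_mul2r (leq_trans cardQ2) ?orbT//.
    by rewrite -[X in (_ <= X)%N]mul1n leq_mul2r Q2le1 orbT.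
  rewrite -(ler_nat R) natrM => Mle.
  have W2 : #|` W|%:R <= 2%:R * expR (alpha * #|` E0|%:R) by lra.
  have four : 4%:R <= expR (c * #|` E0|%:R).
    apply: le_trans (_ : expR (1 + 1) <= _); last by rewrite ler_expR; lra.
    rewrite expRD; have := @expR_ge1Dx R 1; nra.
  have : NX <= expR (beta * #|` E0|%:R).
    apply: le_trans X2M _.
    have -> : beta * #|` E0|%:R = c * #|` E0|%:R + c * #|` E0|%:R + alpha * #|` E0|%:R.
      by rewrite /c; field.
    rewrite !expRD.
    apply: le_trans (_ : 2%:R * (expR (c * #|` E0|%:R) * (2%:R * expR (alpha * #|` E0|%:R))) <= _).
      rewrite ler_pM2l//; apply: le_trans Mle _.
      by apply: ler_pM.
    have := expR_gt0 (alpha * #|` E0|%:R); have := expR_gt0 (c * #|` E0|%:R).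
    set u := expR _ in four *; set v := expR _ => u0 v0.
    rewrite (_ : 2%:R * _ = 4%:R * (u * v)); last by ring.
    by rewrite -mulrA ler_pM2r// mulr_gt0.
  by rewrite leNgt NXlt.
have [t [t' [tQ t'Q tt']]] := card_gt1P Q2_gt1.
have [g0 g0E dg] := xsP t t' tt'.
(* The two orbits are restarted at the time [g0] when they are [d] apart; the times [g * g0] with
   [g] in [F] lie in [E]. *)
exists j, tau, (a g0 (xs t)), (a g0 (xs t')); split=> //; last first.
  move=> g gF; rewrite -!topactM; apply: close => //.
  by apply: fset_prodP; rewrite // in_fset1U gF orbT.
have [pic _ pieq] := pi_factor.
have labt : lab t = lab t' by apply: labQ1; exact: (fintype.subsetP Q2Q1).
(* The common member of the join puts both images at time [g0] in one ball of radius [e / 2]. *)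
have [V VC labE] := WC _ (valP (lab t)).
have := labP t; have := labP t'; rewrite -labt labE => /(_ _ g0E) /= V2 /(_ _ g0E) /= V1.
have [y _ yV] := VC g0 g0E; rewrite -yV in V1 V2.
have /= := interior_subset V1; have /= := interior_subset V2; rewrite !ballEmdist /= => y2 y1.
by rewrite !pieq; have := metric_triangle (b g0 (pi (xs t))) y (b g0 (pi (xs t')));
  rewrite (metric_sym _ y); lra.
Qed.

End EntropyGap.

(** * Limits along an ultrafilter *)

Section Ultralimits.
Variables (I : Type) (W : set_system I).
Hypothesis UW : UltraFilter W.

Lemma ultra_cvg (X : topologicalType) (u : I -> X) :
  compact [set: X] -> exists x : X, u @ W --> x.
Proof.
move=> Xc; have [x [_ xcl]] := Xc (u @ W) _ filterT.
exists x => B xB; have [//|WB] := in_ultra_setVsetC (u @^-1` B) UW.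
by have [y [nB yB]] := xcl (~` B) B WB xB.
Qed.

(** If each of the finitely many values were eventually avoided, all would be at once. *)
Lemma ultra_const (T : finType) (u : I -> T) : exists v, W [set i | u i = v].
Proof.
apply: contrapT => nov.
have WF := @filter_filter _ _ (@ultra_proper _ _ UW).
have : \forall i \near W, forall v, u i <> v.
  apply: filter_forall => v; have [Wv|//] := in_ultra_setVsetC [set i | u i = v] UW.
  by exfalso; apply: nov; exists v.
by move=> /filter_ex[i /(_ (u i))].
Qed.

End Ultralimits.

Section LowEntropyFunction.
Context (R : realType) (G : groupType) (X Y : metricType R).
Local Open Scope ring_scope.
Variables (a : topological_action G X) (b : topological_action G Y) (pi : X -> Y).
Hypothesis G_infinite : infinite_set [set: G].
Hypotheses (Xc : compact [set: X]) (Yc : compact [set: Y]).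
Hypothesis pi_factor : factor_map a b pi.
Variables (U : set (set X)) (alpha beta : R).
Hypothesis Uop : open_cover U.
Hypothesis alpha_beta : alpha < beta.
Hypothesis X_large : forall S, folner_filter G S ->
  exists2 E, S E & beta < ln (subcover_number R (cover_join a U E)) / #|` E|%:R.
Hypothesis Y_small : forall C, open_cover C -> exists2 S, folner_filter G S &
  forall E, S E -> ln (subcover_number R (cover_join b C E)) / #|` E|%:R <= alpha.

(** [close_itineraries] gives a pair for every finite set of times and every scale. Along an
    ultrafilter refining these indices, the shell and each digit of [tau] stabilize and the pairs
    converge. *)
Lemma low_entropy_function (x0 : X) (r : R) : 0 < r ->
  exists f : X -> R, [/\ continuous f, f x0 = 0, forall z, r <= mdist x0 z -> f z = 1 &
    exists x x', [/\ x <> x', pi x = pi x' & forall g, f (a g x) = f (a g x')]].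
Proof.
move=> r0.
have [d d0 dU] := lebesgue_number Xc Uop.
have [K K0 KP] := close_itineraries G_infinite Xc Yc pi_factor Uop alpha_beta dU X_large Y_small.
have [rad [radP radr]] := exists_nested_radii a x0 (quotients K) r0.
pose I := ({fset G} * nat)%type.
pose good (i : I) (p : 'I_#|` K| * (nat -> 'I_4) * (X * X)) := [/\ d <= mdist p.2.1 p.2.2,
  mdist (pi p.2.1) (pi p.2.2) < 2%:R ^- i.2 &
  forall g, g \in i.1 -> `|stairs p.1.2 i.2 (bump x0 rad p.1.1 (a g p.2.1)) -
    stairs p.1.2 i.2 (bump x0 rad p.1.1 (a g p.2.2))| <= 2%:R ^- i.2].
have /choice[p pP] : forall i, exists p, good i p.
  move=> [F k]; have pos : 0 < 2%:R ^- k :> R by rewrite invr_gt0 exprn_gt0.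
  have [j [tau [x [x' H]]]] := KP x0 rad radP F k _ pos.
  by exists (j, tau, (x, x')).
pose W0 := filter_from [set: I] (fun i => [set i' : I | (i.1 `<=` i'.1)%fset /\ (i.2 <= i'.2)%N]).
have W0F : ProperFilter W0.
  apply: filter_from_proper => [|i _]; last by exists i; split=> /=.
  apply: filter_from_filter; first by exists (fset0, 0%N).
  move=> i i' _ _; exists ((i.1 `|` i'.1)%fset, maxn i.2 i'.2) => // i2 /=.
  by rewrite fsubUset geq_max => -[/andP[? ?] /andP[? ?]].
have [W [UW W0W]] := ultraFilterLemma W0F.
have WF := @filter_filter _ _ (@ultra_proper _ _ UW).
have Wlarge g k : \forall i \near W, g \in i.1 /\ (k <= i.2)%N.
  by apply: W0W; exists ([fset g]%fset, k) => // i /=; rewrite fsub1set.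
have [x xP] := ultra_cvg UW (fun i => (p i).2.1) Xc.
have [x' x'P] := ultra_cvg UW (fun i => (p i).2.2) Xc.
have [j jP] := ultra_const UW (fun i => (p i).1.1).
have /choice[tau tauP] : forall m, exists t, W [set i | (p i).1.2 m = t].
  by move=> m; exact: (ultra_const UW (fun i => (p i).1.2 m)).
(* A fixed stage involves finitely many digits, so it stabilizes although the whole sequence need
   not. *)
have tau_eq m : \forall i \near W, stairs (p i).1.2 m =1 stairs tau m :> (R -> R).
  have : \forall i \near W, forall l : 'I_m, (p i).1.2 l = tau l.
    apply: (@filter_forall _ _ (fun (l : 'I_m) i => (p i).1.2 l = tau l)) => l.
    exact: tauP.
  by apply: filterS => i H; apply: eq_stairs => l lm; exact: (H (Ordinal lm)).
have [theta [theta_cont theta0 theta1 thetaP]] := stairs_limit R tau.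
have bump01 z : 0 <= bump x0 rad j z <= 1 by exact: bump_itv.
exists (fun z => theta (bump x0 rad j z)); split.
- move=> z; apply: (@continuous_comp _ _ _ (bump x0 rad j) theta); last exact: theta_cont.
  exact: continuous_bump.
- rewrite (bump_in radP) ?mdistxx//; have [mono _ _] := radP.
  by case/andP: (mono j) => /ltW.
- move=> z rz; rewrite (bump_out radP)//.
  by apply: le_trans rz; apply: le_trans radr; exact: nested_radii_le radP _.
exists x, x'.
have near_dist (Z : metricType R) (h : X -> Z) (hc : continuous h) e : 0 < e ->
    \forall i \near W, mdist (h x) (h (p i).2.1) < e /\ mdist (h x') (h (p i).2.2) < e.
  move=> e0; apply: filterI.
    have : h (p i).2.1 @[i --> W] --> h x by apply: (cvg_comp _ _ xP); exact: hc.
    move=> /(_ [set z | mdist (h x) z < e]); apply.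
    by apply/(nbhs_mdist (h x) (fun z => mdist (h x) z < e)); exists e.
  have : h (p i).2.2 @[i --> W] --> h x' by apply: (cvg_comp _ _ x'P); exact: hc.
  move=> /(_ [set z | mdist (h x') z < e]); apply.
  by apply/(nbhs_mdist (h x') (fun z => mdist (h x') z < e)); exists e.
split.
- move=> xx'.
  have idc : continuous (@id X) by move=> z; exact: cvg_id.
  have [i [xi x'i]] := filter_ex (near_dist X id idc _ (divr_gt0 d0 (ltr0n _ 2))).
  have [dp _ _] := pP i; rewrite /= xx' in xi x'i.
  have := metric_triangle (p i).2.1 x' (p i).2.2; rewrite (metric_sym _ x'); lra.
- have [pic _ _] := pi_factor; apply: mdist_positivity; apply/eqP.
  rewrite eq_le mdist_ge0 andbT leNgt; apply/negP => D0.
  have [k kD] := pow2_small (divr_gt0 D0 (ltr0n _ 3)).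
  have [i [[xi x'i] [_ ki]]] := filter_ex (filterI
    (near_dist Y pi pic _ (divr_gt0 D0 (ltr0n _ 3))) (Wlarge 1%g k)).
  have [_ close _] := pP i.
  have kki : 2%:R ^- (i.2) <= 2%:R ^- k :> R.
    by rewrite lef_pV2 ?posrE ?exprn_gt0// ler_weXn2l// ler1n.
  have := metric_triangle (pi x) (pi (p i).2.1) (pi x').
  have := metric_triangle (pi (p i).2.1) (pi (p i).2.2) (pi x').
  by rewrite (metric_sym (pi (p i).2.2)); lra.
- move=> g; apply/eqP; rewrite -subr_eq0 -normr_le0 leNgt; apply/negP => D0.
  (* The comparison is made at a fixed stage [m], a continuous function. With the difference cut in
     20, each of the two points costs two units for the limit staircase, one for convergence and two
     for the later stages; the closeness of the pair costs one more, eleven in all. *)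
  have [m mD] := pow2_small (divr_gt0 D0 (ltr0n _ 20)).
  pose h z := stairs tau m (bump x0 rad j (a g z)).
  have hc : continuous h.
    move=> z; apply: (@continuous_comp _ _ _ (fun z => bump x0 rad j (a g z)) (stairs tau m)).
      apply: (@continuous_comp _ _ _ (a g) (bump x0 rad j)); first exact: topact_continuous.
      exact: continuous_bump.
    exact: continuous_stairs.
  have near_h e : 0 < e -> \forall i \near W, `|h x - h (p i).2.1| < e /\ `|h x' - h (p i).2.2| < e.
    move=> e0; apply: filterI.
      have : h (p i).2.1 @[i --> W] --> h x by apply: (cvg_comp _ _ xP); exact: hc.
      by move=> /cvgrPdist_lt; apply.
    have : h (p i).2.2 @[i --> W] --> h x' by apply: (cvg_comp _ _ x'P); exact: hc.
    by move=> /cvgrPdist_lt; apply.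
  have [i [[[[hx hx'] [gi mi]] /= ji] taui]] := filter_ex (filterI (filterI (filterI
    (near_h _ (divr_gt0 D0 (ltr0n _ 20))) (Wlarge g m)) jP) (tau_eq m)).
  have [_ _ /(_ g gi)] := pP i; rewrite ji => close.
  have kki : 2%:R ^- (i.2) <= 2%:R ^- m :> R.
    by rewrite lef_pV2 ?posrE ?exprn_gt0// ler_weXn2l// ler1n.
  have pos2 : 0 < 2%:R ^- i.2 :> R by rewrite invr_gt0 exprn_gt0.
  have cauchy z : `|stairs (p i).1.2 i.2 (bump x0 rad j (a g z)) - h z| <= 2%:R * 2%:R ^- m.
    rewrite /h -taui; have := stairs_cauchy (p i).1.2 m (i.2 - m) (bump01 (a g z)).
    by rewrite subnKC//; move/le_trans; apply; rewrite gerBl mulr_ge0// ltW.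
  have t1 := thetaP m _ (bump01 (a g x)); have t2 := thetaP m _ (bump01 (a g x')).
  rewrite -/(h x) in t1; rewrite -/(h x') in t2.
  have c1 := cauchy (p i).2.1; have c2 := cauchy (p i).2.2.
  move: D0 mD hx hx' t1 t2 c1 c2 close.
  set u := theta _; set v := theta _.
  set y1 := stairs _ i.2 _; set y2 := stairs _ i.2 _.
  rewrite !ler_norml !ltr_norml; case: (ger0P (u - v)) => N D0 mD /andP[? ?] /andP[? ?]
    /andP[? ?] /andP[? ?] /andP[? ?] /andP[? ?] /andP[? ?]; lra.
Qed.

End LowEntropyFunction.

(** * The factor defined by the itineraries of a function *)

Section IntermediateFactor.
Context (R : realType) (G : groupType) (X Y : metricType R).
Variables (a : topological_action G X) (b : topological_action G Y) (pi : X -> Y).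
Hypothesis Xc : compact [set: X].
Hypothesis pi_factor : factor_map a b pi.
Variable f : X -> R.
Hypothesis f_cont : continuous f.
Local Open Scope quotient_scope.

(** This is the kernel of the map sending [x] to [pi x] and all the [f (a g x)]; the quotient models
    its image in the product of [Y] and [R ^ G]. *)
Definition same_itinerary (x y : X) : bool :=
  `[< pi x = pi y /\ forall g, f (a g x) = f (a g y) >].

Lemma same_itinerary_refl : reflexive same_itinerary.
Proof. by move=> x; apply/asboolP. Qed.

Lemma same_itinerary_sym : symmetric same_itinerary.
Proof. by move=> x y; apply/asboolP/asboolP => -[E1 E2]; split=> [|g]; rewrite ?E1 ?E2. Qed.

Lemma same_itinerary_trans : transitive same_itinerary.
Proof.
move=> y x z /asboolP[E1 E2] /asboolP[E1' E2']; apply/asboolP.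
by split=> [|g]; [rewrite E1|rewrite E2].
Qed.

Definition itinerary_equiv : equiv_rel X :=
  EquivRel same_itinerary same_itinerary_refl same_itinerary_sym same_itinerary_trans.

Definition itinerary_space : topologicalType := quotient_topology {eq_quot itinerary_equiv}.

Let p (x : X) : itinerary_space := \pi_(quotient_topology {eq_quot itinerary_equiv}) x.

Let rep (z : itinerary_space) : X := @repr _ (quotient_topology {eq_quot itinerary_equiv}) z.

Let p_cont : continuous p.
Proof. exact: pi_continuous. Qed.

Let pE x y : p x = p y <-> pi x = pi y /\ forall g, f (a g x) = f (a g y).
Proof.
split=> [/eqmodP/asboolP//|E].
by apply/eqmodP/asboolP.
Qed.

Let repK z : p (rep z) = z.
Proof. exact: reprK. Qed.

(** [rep] need not be continuous: composing [h \o rep] with the projection gives back [h], and the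
    quotient topology asks for no more. *)
Let descends (T : topologicalType) (h : X -> T) :
  continuous h -> (forall x y, p x = p y -> h x = h y) -> continuous (h \o rep).
Proof.
move=> hc hp; apply/quotient_continuous.
rewrite (_ : _ \o _ = h)//; apply/funext => x /=.
by apply: hp; exact: repK.
Qed.

Let act_descends g x y : p x = p y -> p (a g x) = p (a g y).
Proof.
have [_ _ pieq] := pi_factor.
move=> /pE[E1 E2]; apply/pE; split; first by rewrite !pieq E1.
by move=> h; rewrite -!topactM.
Qed.

Definition itinerary_action : topological_action G itinerary_space.
Proof.
exists (fun g z => p (a g (rep z))).
- by move=> z; rewrite topact1 repK.
- by move=> g h z; rewrite topactM; apply: act_descends; rewrite repK.
- move=> g; apply: (@descends _ (p \o a g)) => [x|x y]; last exact: act_descends.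
  by apply: continuous_comp; [exact: topact_continuous|exact: p_cont].
Defined.

Let separates (T : topologicalType) (h : itinerary_space -> T) z z' :
  continuous h -> hausdorff_space T -> cluster (nbhs z) z' -> h z = h z'.
Proof.
move=> hc TH zz'; apply: TH => A B /hc Az /hc Bz'.
by have [w [Aw Bw]] := zz' _ _ Az Bz'; exists (h w).
Qed.

(** The maps induced by [pi] and by the [f \o a g] are continuous into Hausdorff spaces and together
    separate the points of the quotient. *)
Lemma hausdorff_itinerary_space : hausdorff_space itinerary_space.
Proof.
have [pic _ _] := pi_factor.
move=> z z' zz'; rewrite -(repK z) -(repK z'); apply/pE; split.
  apply: (@separates _ (pi \o rep)) zz'; last exact: metric_hausdorff.
  by apply: descends => // x y /pE[].
move=> g; apply: (@separates _ ((f \o a g) \o rep)) zz'; last exact: Rhausdorff.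
apply: descends => [x|x y /pE[_ E]]; last exact: E.
by apply: continuous_comp; [exact: topact_continuous|exact: f_cont].
Qed.

(** The map from [X] identifies [x] and [x'], and the map to [Y] identifies the distinct classes of
    [x0] and [x0']. Neither is injective, so the factor is strictly intermediate. *)
Lemma itinerary_factor_collapses (x0 x0' x x' : X) :
  topologically_prime_extension a b pi ->
  pi x0 = pi x0' -> f x0 <> f x0' ->
  x <> x' -> pi x = pi x' -> (forall g, f (a g x) = f (a g x')) -> False.
Proof.
have [pic pisurj pieq] := pi_factor.
move=> [_ prime] pi0 f0 xx' pixx' fxx'; apply: prime.
exists itinerary_space, itinerary_action, p, (pi \o rep).
have q_p y : pi (rep (p y)) = pi y.
  by have /pE[] := repK (p y).
split; last split.
- split.
  + have -> : [set: itinerary_space] = p @` [set: X].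
      by apply/seteqP; split=> // z _; exists (rep z).
    apply: continuous_compact Xc; apply: continuous_subspaceT; exact: p_cont.
  + exact: hausdorff_itinerary_space.
  + split=> [//|z _|g y]; first by exists (rep z).
    by apply: act_descends; rewrite repK.
  + split=> [|y _|g z /=]; last by rewrite q_p pieq.
      by apply: descends => // y z /pE[].
    by have [y' _ <-] := pisurj y I; exists (p y') => //=; exact: q_p.
  + exact: q_p.
- move=> [_ [h [_ ph _]]]; apply: xx'; rewrite -(ph x) -(ph x'); congr h.
  exact/pE.
- move=> [_ [h [_ qh _]]]; apply: f0.
  have /pE[_ /(_ 1%g)] : p x0 = p x0' by rewrite -(qh (p x0)) -(qh (p x0')) /= !q_p pi0.
  by rewrite !topact1.
Qed.

End IntermediateFactor.

(** * Entropy of a factor *)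

Section FactorEntropy.
Context (R : realType) (G : groupType) (X Y : topologicalType).
Variables (a : topological_action G X) (b : topological_action G Y) (pi : X -> Y).
Hypothesis pi_factor : factor_map a b pi.

Let pre (A : set Y) : set X := pi @^-1` A.

Let pre_inj : injective pre.
Proof.
have [_ surj _] := pi_factor; move=> A B AB; apply/seteqP; split=> y;
  have [x _ <-] := surj y I; rewrite -[_ (pi x)]/(pre _ x); by [rewrite AB|rewrite -AB].
Qed.

(** As [pi] is onto, taking preimages is injective on sets and a family covers [Y] exactly when its
    preimages cover [X]; subcovers correspond with their cardinals. *)
Lemma subcover_number_preimage (C : set (set Y)) :
  subcover_number R (pre @` C) = subcover_number R C.
Proof.
have [_ surj _] := pi_factor.
congr (inf _); congr (image _ _); apply/seteqP; split=> n [W [WC WT Wn]].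
  exists [set A | C A /\ W (pre A)].
  have WE : W = pre @` [set A | C A /\ W (pre A)].
    apply/seteqP; split=> [V WV|_ [A [_ WA] <-]//].
    by have [A CA AV] := WC V WV; exists A => //; rewrite /= AV.
  split=> [A []//||].
    apply/seteqP; split=> // y _; have [x _ <-] := surj y I.
    have [V WV Vx] : (\bigcup_(V in W) V) x by rewrite WT.
    by have [A CA AV] := WC V WV; exists A; [rewrite /= AV|rewrite -AV in Vx].
  apply: card_eq_trans Wn; rewrite {2}WE card_eq_sym.
  by apply: inj_card_eq => ? ? _ _; exact: pre_inj.
exists (pre @` W); split.
- by move=> _ [A WA <-]; exists A => //; exact: WC.
- apply/seteqP; split=> // x _.
  have [A WA Ax] : (\bigcup_(A in W) A) (pi x) by rewrite WT.
  by exists (pre A) => //; exists A.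
- apply: card_eq_trans Wn.
  by apply: inj_card_eq => ? ? _ _; exact: pre_inj.
Qed.

Lemma cover_join_preimage (C : set (set Y)) (E : {fset G}) :
  cover_join a (pre @` C) E = pre @` cover_join b C E.
Proof.
have [_ _ pieq] := pi_factor.
have preE (V : G -> set Y) : \bigcap_(s in [set` E]) (a s @^-1` pre (V s)) =
    pre (\bigcap_(s in [set` E]) (b s @^-1` V s)).
  by apply/seteqP; split=> x Vx s sE; have := Vx s sE; rewrite /pre /= pieq.
apply/seteqP; split=> [_ [V VC ->]|_ [_ [V VC ->] <-]]; last first.
  by exists (pre \o V) => [s sE|]; [exists (V s) => //; exact: VC|rewrite preE].
(* The choice ranges over all of [G], with the dummy value [setT] outside [E]. *)
have /choice[V' V'P] : forall s, exists A, s \in E -> C A /\ pre A = V s.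
  move=> s; have [sE|_] := boolP (s \in E); last by exists setT.
  by have [A CA AV] := VC s sE; exists A.
exists (\bigcap_(s in [set` E]) (b s @^-1` V' s)).
  by exists V' => // s /V'P[].
rewrite -preE; apply: eq_bigcapr => s sE.
by have [_ ->] := V'P s sE.
Qed.

(** Pulling back a cover of [Y] preserves its entropy, so the supremum for [X] includes all the
    values for [Y]. *)
Lemma topological_entropy_factor : (topological_entropy R b <= topological_entropy R a)%E.
Proof.
have [pic surj _] := pi_factor.
apply: ge_ereal_sup => _ [C [Cop CY] <-]; apply: le_ereal_sup_tmp.
exists (cover_entropy R a (pre @` C)).
  exists (pre @` C) => //; split=> [_ [A CA <-]|].
    by move/continuousP: pic; apply; exact: Cop.
  apply/seteqP; split=> // x _.
  have [A CA Ax] : (\bigcup_(A in C) A) (pi x) by rewrite CY.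
  by exists (pre A) => //; exists A.
rewrite /cover_entropy le_eqVlt; apply/orP; left; apply/eqP.
congr (ereal_inf _); apply: eq_imagel => S _; congr (ereal_sup _).
by apply: eq_imagel => E _; rewrite cover_join_preimage subcover_number_preimage.
Qed.

End FactorEntropy.

(** * Contradiction from an entropy gap *)

Section Main.
Context (R : realType).

Lemma real_between (x y : \bar R) : (x < y)%E -> exists r : R, (x < r%:E)%E /\ (r%:E < y)%E.
Proof.
case: x => [x| |]; case: y => [y| |] //=.
- rewrite lte_fin => xy; exists ((x + y) / 2)%R; rewrite !lte_fin; split; lra.
- by move=> _; exists (x + 1)%R; rewrite ltry lte_fin; split=> //; lra.
- by move=> _; exists (y - 1)%R; rewrite ltNyr lte_fin; split=> //; lra.
- by move=> _; exists 0%R; rewrite ltNyr ltry.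
Qed.

End Main.

Theorem theorem5p1 (R : realType) (G : groupType)
    (G_countable : countable [set: G]) (G_infinite : infinite_set [set: G])
    (G_amenable : amenable G)
    (X Y : metricType R)
    (X_compact : compact [set: X]) (Y_compact : compact [set: Y])
    (a : topological_action G X) (b : topological_action G Y)
    (pi : X -> Y) (pi_prime : topologically_prime_extension a b pi) :
  topological_entropy R a = topological_entropy R b.
Proof.
have pi_factor := pi_prime.1.
apply/eqP; rewrite eq_le (topological_entropy_factor _ pi_factor) andbT leNgt.
apply/negP => /ereal_sup_gt[_ [U Uop <-]] ltU.
have [alpha [Ylt alphaU]] := real_between ltU.
have [beta [alpha_beta betaU]] := real_between alphaU.
rewrite lte_fin in alpha_beta.
have X_large S : folner_filter G S ->
    exists2 E, S E & (beta < ln (subcover_number R (cover_join a U E)) / #|` E|%:R)%R.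
  move=> SG; have : (beta%:E < ereal_sup [set (ln (subcover_number R (cover_join a U E))
      / #|` E|%:R)%:E | E in S])%E.
    by apply: lt_le_trans betaU _; apply: ereal_inf_lbound; exists S.
  by move=> /ereal_sup_gt[_ [E SE <-]]; rewrite lte_fin => ?; exists E.
have Y_small C : open_cover C -> exists2 S, folner_filter G S &
    forall E, S E -> (ln (subcover_number R (cover_join b C E)) / #|` E|%:R <= alpha)%R.
  move=> Cop; have : (cover_entropy R b C < alpha%:E)%E.
    by apply: le_lt_trans Ylt; apply: ereal_sup_ubound; exists C.
  move=> /ereal_inf_lt[_ [S SG <-]] Slt; exists S => // E SE.
  rewrite -lee_fin; apply: le_trans (ltW Slt).
  by apply: ereal_sup_ubound; exists E.
have low := low_entropy_function G_infinite X_compact Y_compact pi_factor Uop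
  alpha_beta X_large Y_small.
(* If [X] is empty then so is [Y], the empty family is a subcover, and [ln] takes its default value
   0; this gives [0 <= alpha] and [beta < 0]. *)
have [x0 _] : exists x0 : X, True.
  apply: contrapT => noX.
  have [|S SG Ssmall] := Y_small [set setT].
    by split=> [_ ->|]; [exact: openT|rewrite bigcup_set1].
  have [E SE] := X_large S SG; have := Ssmall E SE.
  have [_ surj _] := pi_factor.
  rewrite !ln0 ?mul0r.
  - by move=> le_alpha lt_beta; have := lt_le_trans lt_beta le_alpha; rewrite ltNge ltW.
  - apply: le_trans (@subcover_number_le R _ _ fset0 _ _) _; rewrite ?cardfs0//.
    by apply/seteqP; split=> // x _; exfalso; apply: noX; exists x.
  - apply: le_trans (@subcover_number_le R _ _ fset0 _ _) _; rewrite ?cardfs0//.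
    by apply/seteqP; split=> // y _; have [x] := surj y I; exfalso; apply: noX; exists x.
(* The first use, with an arbitrary center and radius, serves to find two distinct points of one
   fiber. The second is centered at [x1] with radius their distance, so that [f] is 0 at [x1] and 1
   at [x1']. *)
have [_ [_ _ _ [x1 [x1' [/eqP x1x1' pi1 _]]]]] := low x0 1%R ltr01.
rewrite -mdist_gt0 in x1x1'.
have [f [f_cont f1 f1' [x [x' [xx' pixx' fxx']]]]] := low x1 _ x1x1'.
apply: (itinerary_factor_collapses X_compact pi_factor f_cont pi_prime pi1 _ xx' pixx' fxx').
by rewrite f1 f1'//; apply/eqP; rewrite eq_sym oner_eq0.
Qed.
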